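(* Let $p\in\mathbb N$, $m\in\mathbb Z$, $\alpha\in\mathbb R$, $\beta>0$ with $\alpha+p\beta>0$, $\mu>0$, $-1\le B<A\le1$ and $\kappa=(1-A)/(1-B)$. If $f\in\mathcal A_p$ satisfies $$\operatorname{Re}\left\{\frac{\Theta_p^{m+1}(\alpha,\beta)f(z)}{\Theta_p^{m}(\alpha,\beta)f(z)}\right\}>\kappa\quad(z\in\mathbb U),$$ then $$\operatorname{Re}\left\{(1-\mu)\frac{\Theta_p^{m+1}(\alpha,\beta)f(z)}{\Theta_p^{m}(\alpha,\beta)f(z)}+\mu\frac{\Theta_p^{m+2}(\alpha,\beta)f(z)}{\Theta_p^{m+1}(\alpha,\beta)f(z)}\right\}>\kappa\quad\text{for }|z|<R,$$ where $$R=\begin{cases}\dfrac{(\alpha+p\beta)(1-\kappa)+\mu\beta-\sqrt{\{(\alpha+p\beta)\kappa-\mu\beta\}^2+2\mu\beta(\alpha+p\beta)}}{(\alpha+p\beta)(1-2\kappa)},&\kappa\ne\frac12,\\[3mm]\dfrac{\alpha+p\beta}{2\{(\alpha+p\beta)(1-\kappa)+\mu\beta\}},&\kappa=\frac12.\end{cases}$$ The result is the best possible (the radius $R$ cannot be replaced by a larger one).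
   Context: $\mathbb U=\{z\in\mathbb C:|z|<1\}$. $\mathcal A_p$ is the class of functions $f(z)=z^p+\sum_{k\ge p+1}a_kz^k$ which are analytic and $p$-valent in $\mathbb U$. For $m\in\mathbb Z$ the linear operator $\Theta_p^m(\alpha,\beta)$ on $\mathcal A_p$ is $$\Theta_p^m(\alpha,\beta)f(z)=z^p+\sum_{k=p+1}^\infty\left(\frac{\alpha+k\beta}{\alpha+p\beta}\right)^m a_kz^k .$$ A real-part inequality for a quotient is understood to include that the quotient is analytic in the disk concerned after removing the removable singularity at $0$.
   Formalization: The class A_p is taken as all analytic f(z)=z^p+... in U, without requiring f to be globally p-valent; with that requirement the sharpness claim fails (e.g. p=1, m=0, A=1, B=-1, β=μ=1, α=99: the inequality holds for |z|<0.9 while R≈0.868). *)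

(* Defs.v *)
From HB Require Import structures.
From mathcomp Require Import all_boot all_order all_algebra.
From mathcomp Require Import all_classical all_reals all_analysis.
From mathcomp Require Export complex.

Set Implicit Arguments.
Unset Strict Implicit.
Unset Printing Implicit Defensive.

Import Order.TTheory GRing.Theory Num.Theory.
Import numFieldNormedType.Exports.
Local Open Scope classical_set_scope.
Local Open Scope ring_scope.

(* Typing R[i] as a numFieldType gives it the topology and the normed-module
   structure MathComp-Analysis puts on any numFieldType, so that [derivable]
   and [derive1n] at this type are complex differentiation. *)
Definition Cplx (R : realType) : numFieldType := R[i].

Section definitions.
Variable R : realType.
Local Notation C := (Cplx R).
Implicit Types (r kappa alpha beta mu : R) (f g N D : C -> C) (z : C).

Definition toC r : C := r%:C%C.

Definition disk r : set C := [set z | `|z| < toC r].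

Definition holomorphic_on_disk r g : Prop :=
  forall z, disk r z -> derivable g z 1.

Definition power_partial (p : nat) (a : nat -> C) z (n : nat) : C :=
  z ^+ p + \sum_(p.+1 <= k < n) a k * z ^+ k.

(* Here "p-valent" is carried by the normalisation alone (a zero of order p at
   the origin): it is not required that f take every value at most p times in
   the unit disk.  [Theta] does not preserve that global property, and the
   radius below is in general not the best possible among functions with it. *)
Definition class_Ap (p : nat) f : Prop :=
  holomorphic_on_disk 1 f /\
  exists a : nat -> C,
    forall z, disk 1 z -> power_partial p a z @ \oo --> f z.

Definition taylor_coef f (k : nat) : C := derive1n k f 0 / k`!%:R.

Definition Theta (p : nat) (m : int) alpha beta f z : C :=
  limn (power_partial p
    (fun k => toC (((alpha + k%:R * beta) / (alpha + p%:R * beta)) ^ m)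
              * taylor_coef f k) z).

(* q is the quotient N / D, analytic on the disk of radius r once the
   singularity at 0 is removed. *)
Definition analytic_quotient r N D q : Prop :=
  holomorphic_on_disk r q /\
  forall z, disk r z -> z != 0 -> D z != 0 /\ q z = N z / D z.

Definition hypothesis_on_disk (p : nat) (m : int) alpha beta kappa r f : Prop :=
  exists q : C -> C,
    analytic_quotient r (Theta p (m + 1) alpha beta f)
                        (Theta p m alpha beta f) q /\
    forall z, disk r z -> kappa < complex.Re (q z).

Definition conclusion_on_disk (p : nat) (m : int) alpha beta mu kappa r f
    : Prop :=
  exists q1 q2 : C -> C,
    [/\ analytic_quotient r (Theta p (m + 1) alpha beta f)
                            (Theta p m alpha beta f) q1,
        analytic_quotient r (Theta p (m + 2) alpha beta f)
                            (Theta p (m + 1) alpha beta f) q2 &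
        forall z, disk r z ->
          kappa < complex.Re (toC (1 - mu) * q1 z + toC mu * q2 z)].

Definition sharp_radius (p : nat) alpha beta mu kappa : R :=
  let c := alpha + p%:R * beta in
  if kappa == 2^-1 then c / (2 * (c * (1 - kappa) + mu * beta))
  else (c * (1 - kappa) + mu * beta
        - Num.sqrt ((c * kappa - mu * beta) ^+ 2 + 2 * mu * beta * c))
       / (c * (1 - 2 * kappa)).

End definitions.

(* Main.v *)
(** Write [Theta^m f = z^p G_m].  Then [G_{m+1} = G_m + tau z G_m'] with
    [tau = beta / (alpha + p beta)], so for [Q = G_{m+1} / G_m] the combination in
    the conclusion is [Q + mu tau z Q' / Q].  The Schwarz-Pick inequality for [Q]
    in the half-plane [Re > kappa], [|Q'| (1 - r^2) <= 2 (Re Q - kappa)], and the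
    Harnack bound [Re Q >= (1 - (1 - 2 kappa) r) / (1 + r)] keep its real part
    above [kappa] while [(1 - r) (1 - (1 - 2 kappa) r) > 2 mu tau r], i.e. for
    [r < R].  Both inequalities are equalities at [z = - r] for
    [Q = (1 + (1 - 2 kappa) z) / (1 - z)], i.e. for [G_m = (1 - z)^(- s)] with
    [s = 2 (1 - kappa) / tau].

    No integration theory is needed: a divided difference of a power series
    converging on the unit disk is again one, so quotients of such series have
    Taylor expansions of every order at every point of the disk; second order
    suffices for a maximum principle. *)

(* Every analytic statement concerns quotients [psum a / psum b] with zero-free denominator, a class
   that contains no Cayley transforms or Blaschke factors as such. Schwarz-Pick at [z] is therefore
   proved with denominators cleared: the Cayley transform of the quotient, divided by the Blaschke
   factor of [z], is exhibited as a quotient of two explicit power series, the zero at [z] being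
   removed by a divided difference. The maximum principle is available on circles of radius [r < 1]
   only, where the Blaschke factor is not unimodular; it yields a bound [1 + O(1 - r)], and [r] then
   tends to 1. Since [Theta] is built from derivatives at the origin, termwise differentiation must
   come before any formula for it. The bound [kappa >= 0] makes the half-plane avoid 0, so that the
   second quotient of the conclusion has a zero-free denominator. The extremal function is the
   preimage of [z^p (1 - z)^(- s)] under the operator of order [m], found by applying order [- m] to
   coefficients; that [(1 - z)^(- s)] has no zeros is read off its coefficients. *)
From HB Require Import structures.
Require Import Defs.
From mathcomp Require Import all_boot all_order all_algebra.
From mathcomp Require Import reals complex.
From mathcomp Require Import ring lra.
From mathcomp Require Import all_classical all_analysis.
Import Order.TTheory GRing.Theory Num.Theory.
Import numFieldNormedType.Exports.

Set Implicit Arguments.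
Unset Strict Implicit.
Unset Printing Implicit Defensive.
Local Open Scope classical_set_scope.
Local Open Scope ring_scope.

(* Locked: unification must not compare two moduli by unfolding them. *)
HB.lock Definition cmod (R : realType) (z : Cplx R) : R := complex.Re `|z|.

(** * Real-valued modulus on the complex numbers, whose own norm is complex-valued *)

Section Modulus.
Variable R : realType.
Local Notation C := (Cplx R).
Implicit Types (z w : C) (r s : R).

Lemma norm_cmod z : `|z| = toC (cmod z).
Proof. by case: z => a b; rewrite cmod.unlock normc_def. Qed.

Lemma cmod_ReIm z : cmod z ^+ 2 = complex.Re z ^+ 2 + complex.Im z ^+ 2.
Proof.
case: z => a b; rewrite cmod.unlock normc_def /=.
by rewrite sqr_sqrtr // addr_ge0 // sqr_ge0.
Qed.

Lemma lec_toC r s : (toC r <= toC s) = (r <= s).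
Proof. by rewrite /toC lecR. Qed.

Lemma ltc_toC r s : (toC r < toC s) = (r < s).
Proof. by rewrite /toC ltcR. Qed.

Lemma toC0 : toC 0 = 0 :> C. Proof. by []. Qed.
Lemma toC1 : toC 1 = 1 :> C. Proof. by []. Qed.
Lemma toCD r s : toC (r + s) = toC r + toC s :> C.
Proof. by rewrite /toC (rmorphD (real_complex R)). Qed.
Lemma toCN r : toC (- r) = - toC r :> C.
Proof. by rewrite /toC (rmorphN (real_complex R)). Qed.
Lemma toCM r s : toC (r * s) = toC r * toC s :> C.
Proof. by rewrite /toC (rmorphM (real_complex R)). Qed.
Lemma toCV r : toC (r^-1) = (toC r)^-1 :> C.
Proof. by rewrite /toC (fmorphV (real_complex R)). Qed.
Lemma toCX r n : toC (r ^+ n) = toC r ^+ n :> C.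
Proof. by rewrite /toC (rmorphXn (real_complex R)). Qed.
Lemma toC_nat n : toC n%:R = n%:R :> C.
Proof. by rewrite /toC (rmorph_nat (real_complex R)). Qed.
Lemma toC_eq0 r : (toC r == 0) = (r == 0).
Proof. by rewrite /toC (fmorph_eq0 (real_complex R)). Qed.

Lemma toC_inj : injective (@toC R).
Proof. by move=> r s []. Qed.

Lemma disk_cmod r z : disk r z <-> cmod z < r.
Proof. by rewrite /disk /= norm_cmod ltc_toC. Qed.

Lemma cmod_ge0 z : 0 <= cmod z.
Proof. by rewrite -lec_toC -norm_cmod toC0. Qed.

Lemma cmodM z w : cmod (z * w) = cmod z * cmod w.
Proof. by apply: toC_inj; rewrite toCM -!norm_cmod normrM. Qed.

Lemma cmodV z : cmod z^-1 = (cmod z)^-1.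
Proof. by apply: toC_inj; rewrite toCV -!norm_cmod normfV. Qed.

Lemma cmodX z n : cmod (z ^+ n) = cmod z ^+ n.
Proof. by apply: toC_inj; rewrite toCX -!norm_cmod normrX. Qed.

Lemma ler_cmodD z w : cmod (z + w) <= cmod z + cmod w.
Proof. by rewrite -lec_toC toCD -!norm_cmod ler_normD. Qed.

Lemma cmodN z : cmod (- z) = cmod z.
Proof. by rewrite cmod.unlock normrN. Qed.

Lemma cmodC z w : cmod (z - w) = cmod (w - z).
Proof. by rewrite -cmodN opprB. Qed.

Lemma cmod0 : cmod (0 : C) = 0. Proof. by rewrite cmod.unlock normr0. Qed.
Lemma cmod1 : cmod (1 : C) = 1. Proof. by rewrite cmod.unlock normr1. Qed.

Lemma cmod_eq0 z : (cmod z == 0) = (z == 0).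
Proof. by rewrite -toC_eq0 -norm_cmod normr_eq0. Qed.

Lemma cmod_gt0 z : (0 < cmod z) = (z != 0).
Proof. by rewrite lt_def cmod_eq0 cmod_ge0 andbT. Qed.

Lemma cmod_toC r : cmod (toC r) = `|r|.
Proof.
by apply/eqP; rewrite -(@eqrXn2 _ 2) ?cmod_ge0 // cmod_ReIm /= expr0n addr0
  real_normK ?num_real.
Qed.

Lemma ler_Re_cmod z : `|complex.Re z| <= cmod z.
Proof.
rewrite -(@ler_pXn2r _ 2) ?nnegrE ?cmod_ge0 // cmod_ReIm real_normK ?num_real //.
by rewrite lerDl sqr_ge0.
Qed.

Lemma ler_Im_cmod z : `|complex.Im z| <= cmod z.
Proof.
rewrite -(@ler_pXn2r _ 2) ?nnegrE ?cmod_ge0 // cmod_ReIm real_normK ?num_real //.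
by rewrite lerDr sqr_ge0.
Qed.

Lemma ler_cmod_ReIm z : cmod z <= `|complex.Re z| + `|complex.Im z|.
Proof.
rewrite -(@ler_pXn2r _ 2) ?nnegrE ?cmod_ge0 ?addr_ge0 // cmod_ReIm sqrrD.
by rewrite !real_normK ?num_real // addrAC lerDl mulrn_wge0 ?mulr_ge0.
Qed.

Lemma ReCD z w : complex.Re (z + w) = complex.Re z + complex.Re w.
Proof. by case: z; case: w. Qed.
Lemma ImCD z w : complex.Im (z + w) = complex.Im z + complex.Im w.
Proof. by case: z; case: w. Qed.
Lemma ReCN z : complex.Re (- z) = - complex.Re z.
Proof. by case: z. Qed.
Lemma ImCN z : complex.Im (- z) = - complex.Im z.
Proof. by case: z. Qed.
Lemma ReCM z w : complex.Re (z * w) =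
  complex.Re z * complex.Re w - complex.Im z * complex.Im w.
Proof. by case: z; case: w. Qed.
Lemma ImCM z w : complex.Im (z * w) =
  complex.Re z * complex.Im w + complex.Im z * complex.Re w.
Proof. by case: z => a b; case: w => c d /=. Qed.

Lemma ReIm_eq z w :
  complex.Re z = complex.Re w -> complex.Im z = complex.Im w -> z = w.
Proof. by case: z => a b; case: w => c d /= -> ->. Qed.

Lemma cvg_cmodP {T : Type} (F : set_system T) (FF : Filter F) (u : T -> C) (l : C) :
  u @ F --> l <-> forall e : R, 0 < e -> \forall x \near F, cmod (l - u x) < e.
Proof.
split => [/cvgrPdist_lt h e e0|h].
  have := h (toC e); rewrite -toC0 ltc_toC => /(_ e0).
  by apply: filterS => x; rewrite norm_cmod ltc_toC.
apply/cvgrPdist_lt => e e0.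
(* A positive element of [Cplx R] is real, hence equal to its own modulus. *)
have -> : e = toC (cmod e) by rewrite -norm_cmod gtr0_norm.
have e1 : 0 < cmod e by rewrite cmod_gt0 gt_eqF.
have := h _ e1.
by apply: filterS => x; rewrite norm_cmod ltc_toC.
Qed.

Lemma nbhs_cmodP z (P : set C) :
  nbhs z P <-> exists2 e : R, 0 < e & forall w, cmod (w - z) < e -> P w.
Proof.
split.
  move=> /nbhs_normP [e e0 h].
  exists (cmod e); first by rewrite cmod_gt0 gt_eqF.
  move=> w hw; apply: h => /=.
  by rewrite -(gtr0_norm e0) !norm_cmod ltc_toC cmodC.
move=> [e e0 h]; apply/nbhs_normP; exists (toC e); first by rewrite /= -toC0 ltc_toC.
by move=> w /=; rewrite norm_cmod ltc_toC cmodC; exact: h.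
Qed.

End Modulus.

(** * Power series converging on the unit disk *)

HB.lock Definition psum (R : realType) (a : nat -> Cplx R) (z : Cplx R) : Cplx R :=
  limn (series (fun k => a k * z ^+ k)).

Section PowerSeries.
Variable R : realType.
Local Notation C := (Cplx R).
Implicit Types (z w : C) (r s : R) (a b : nat -> C).

Lemma ler_cmod_sum (u : nat -> C) n :
  cmod (\sum_(0 <= k < n) u k) <= \sum_(0 <= k < n) cmod (u k).
Proof.
elim: n => [|n IH]; first by rewrite !big_geq // cmod0.
by rewrite !big_nat_recr //= (le_trans (ler_cmodD _ _)) // lerD2r.
Qed.

Lemma ReSum (u : nat -> C) n :
  complex.Re (\sum_(0 <= k < n) u k) = \sum_(0 <= k < n) complex.Re (u k).
Proof.
elim: n => [|n IH]; first by rewrite !big_geq.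
by rewrite !big_nat_recr //= ReCD IH.
Qed.

Lemma ImSum (u : nat -> C) n :
  complex.Im (\sum_(0 <= k < n) u k) = \sum_(0 <= k < n) complex.Im (u k).
Proof.
elim: n => [|n IH]; first by rewrite !big_geq.
by rewrite !big_nat_recr //= ImCD IH.
Qed.

Lemma cvg_ReIm (u : nat -> C) (x y : R) :
  (fun n => complex.Re (u n)) @ \oo --> x ->
  (fun n => complex.Im (u n)) @ \oo --> y ->
  u @ \oo --> ((x +i* y)%C : C).
Proof.
move=> /cvgrPdist_lt hx /cvgrPdist_lt hy; apply/cvg_cmodP => e e0.
have e2 : 0 < e / 2 by lra.
near=> n; apply: le_lt_trans (ler_cmod_ReIm _) _.
rewrite (splitr e) ltrD //.
  by have : `|x - complex.Re (u n)| < e / 2 by [near: n; exact: hx];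
    rewrite ReCD ReCN.
by have : `|y - complex.Im (u n)| < e / 2 by [near: n; exact: hy];
  rewrite ImCD ImCN.
Unshelve. all: by end_near. Qed.

(** Real and imaginary parts converge absolutely by comparison, so only the completeness of the
    reals is used. *)
Lemma is_cvg_geometric_bound (u : nat -> C) (M x : R) :
  0 <= x -> x < 1 -> (forall k, cmod (u k) <= M * x ^+ k) ->
  cvgn (series u).
Proof.
move=> x0 x1 hu.
have cvgP (f : C -> R) : (forall z, `|f z| <= cmod z) ->
    cvgn (series (fun k => f (u k))).
  move=> hf; apply: normed_cvg => /=.
  apply: (series_le_cvg (v_ := geometric M x)) => [k|k|k|] //=.
  - by rewrite (le_trans (cmod_ge0 (u k))) //; exact: hu.
  - by rewrite (le_trans (hf _)) //; exact: hu.
  - by apply: is_cvg_geometric_series; rewrite ger0_norm.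
have /cvg_ex [lx hx] := cvgP _ (@ler_Re_cmod R).
have /cvg_ex [ly hy] := cvgP _ (@ler_Im_cmod R).
apply/cvg_ex; exists ((lx +i* ly)%C : C); apply: cvg_ReIm.
  rewrite (_ : (fun n => _) = series (fun k => complex.Re (u k))) //.
  by apply/funext => n; rewrite /series /= ReSum.
rewrite (_ : (fun n => _) = series (fun k => complex.Im (u k))) //.
by apply/funext => n; rewrite /series /= ImSum.
Qed.

Lemma cmod_lim_le (u : nat -> C) (l : C) (K : R) :
  (forall n, cmod (u n) <= K) -> u @ \oo --> l -> cmod l <= K.
Proof.
move=> hu /cvg_cmodP hl; rewrite leNgt; apply/negP => Kl.
have e0 : 0 < cmod l - K by lra.
have [N _ /(_ N (leqnn _)) /= hN] := hl _ e0.
have := ler_cmodD (l - u N) (u N); rewrite subrK.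
by have := hu N; lra.
Qed.

Lemma sum_geometric_le (x : R) n : 0 <= x -> x < 1 ->
  \sum_(0 <= k < n) x ^+ k <= (1 - x)^-1.
Proof.
move=> x0 x1; have x2 : 0 < 1 - x by lra.
rewrite -[leRHS]mul1r ler_pdivlMr //.
suff -> : (\sum_(0 <= k < n) x ^+ k) * (1 - x) = 1 - x ^+ n.
  by rewrite gerBl exprn_ge0.
elim: n => [|n IH]; first by rewrite big_geq // mul0r expr0 subrr.
by rewrite big_nat_recr //= mulrDl IH exprS; ring.
Qed.

(* The radius of convergence of [a] is at least 1. *)
Definition geo a := forall r, 0 <= r -> r < 1 ->
  exists M : R, forall k, cmod (a k) * r ^+ k <= M.

Lemma geo_term a z r M : 0 < r -> (forall k, cmod (a k) * r ^+ k <= M) ->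
  cmod z < r -> forall k, cmod (a k * z ^+ k) <= M * (cmod z / r) ^+ k.
Proof.
move=> r0 hM zr k.
rewrite cmodM cmodX expr_div_n mulrA ler_pdivlMr ?exprn_gt0 //.
by rewrite mulrAC ler_wpM2r // exprn_ge0 // cmod_ge0.
Qed.

Lemma psum_cvg a z : geo a -> cmod z < 1 ->
  series (fun k => a k * z ^+ k) @ \oo --> psum a z.
Proof.
move=> ga z1; rewrite psum.unlock; have z0 := cmod_ge0 z.
have [||M hM] := ga ((1 + cmod z) / 2); [lra|lra|].
apply: (@is_cvg_geometric_bound _ M (cmod z / ((1 + cmod z) / 2))).
- by rewrite divr_ge0 //; lra.
- by rewrite ltr_pdivrMr; lra.
- by apply: geo_term => //; lra.
Qed.

Lemma psumE a z l : series (fun k => a k * z ^+ k) @ \oo --> l -> psum a z = l.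
Proof. by move=> h; rewrite psum.unlock; apply: cvg_lim h; exact: norm_hausdorff. Qed.

Lemma psumSE a z l :
  (fun n => series (fun k => a k * z ^+ k) n.+1) @ \oo --> l -> psum a z = l.
Proof. by move=> h; apply: psumE; rewrite -cvg_shiftS. Qed.

Lemma psum_bounded a r : geo a -> 0 <= r -> r < 1 ->
  exists2 K, 0 <= K & forall z, cmod z <= r -> cmod (psum a z) <= K.
Proof.
move=> ga r0 r1; set s := (1 + r) / 2.
have s0 : 0 < s by rewrite /s; lra.
have rs : r < s by rewrite /s; lra.
have [||M hM] := ga s; [lra|rewrite /s; lra|].
have M0 : 0 <= M by have := hM 0; rewrite expr0 mulr1; apply: le_trans; rewrite cmod_ge0.
have x1 : r / s < 1 by rewrite ltr_pdivrMr // mul1r.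
have x0 : 0 <= r / s by rewrite divr_ge0 // ltW.
exists (M * (1 - r / s)^-1); first by rewrite mulr_ge0 // invr_ge0; lra.
move=> z zr; apply: cmod_lim_le (psum_cvg ga _); last by lra.
move=> n; apply: le_trans (ler_cmod_sum _ _) _.
apply: (@le_trans _ _ (\sum_(0 <= k < n) M * (r / s) ^+ k)); last first.
  by rewrite -mulr_sumr ler_wpM2l // sum_geometric_le.
apply: ler_sum => k _; apply: le_trans (geo_term s0 hM _ k) _; first by lra.
rewrite ler_wpM2l //; apply: lerXn2r; rewrite ?nnegrE //.
  by rewrite divr_ge0 ?cmod_ge0 // ltW.
by rewrite ler_pM2r // invr_gt0.
Qed.

Lemma geoD a b : geo a -> geo b -> geo (fun k => a k + b k).
Proof.
move=> ga gb r r0 r1; have [M hM] := ga _ r0 r1; have [N hN] := gb _ r0 r1.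
exists (M + N) => k; apply: le_trans (lerD (hM k) (hN k)).
by rewrite -mulrDl ler_wpM2r ?exprn_ge0 // ler_cmodD.
Qed.

Lemma geoZ c a : geo a -> geo (fun k => c * a k).
Proof.
move=> ga r r0 r1; have [M hM] := ga _ r0 r1.
by exists (cmod c * M) => k; rewrite cmodM -mulrA ler_wpM2l // cmod_ge0.
Qed.

Lemma psumD a b z : geo a -> geo b -> cmod z < 1 ->
  psum (fun k => a k + b k) z = psum a z + psum b z.
Proof.
move=> ga gb z1; apply: psumE.
rewrite (_ : series _ = series (fun k => a k * z ^+ k) + series (fun k => b k * z ^+ k)).
  by apply: cvgD; exact: psum_cvg.
apply/funext => n; rewrite /series /= /GRing.add /= -big_split /=.
by apply: eq_bigr => k _; rewrite mulrDl.
Qed.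

Lemma psumZ c a z : geo a -> cmod z < 1 ->
  psum (fun k => c * a k) z = c * psum a z.
Proof.
move=> ga z1; apply: psumE.
rewrite (_ : series _ = (fun n => c * series (fun k => a k * z ^+ k) n)).
  by apply: cvgMl_tmp; exact: psum_cvg.
apply/funext => n; rewrite /series /= mulr_sumr.
by apply: eq_bigr => k _; rewrite mulrA.
Qed.

Lemma psum0 a : psum a 0 = a 0.
Proof.
apply: psumSE.
have -> : (fun n => series (fun k => a k * 0 ^+ k) n.+1) = cst (a 0%N); last exact: cvg_cst.
apply/funext => n; rewrite /series /= big_nat_recl // expr0 mulr1.
by rewrite big1 ?addr0 // => k _; rewrite exprS mul0r mulr0.
Qed.

Definition pshift a k := if k is k'.+1 then a k' else 0.

Lemma geo_shift a : geo a -> geo (pshift a).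
Proof.
move=> ga r r0 r1; have [M hM] := ga _ r0 r1; exists M => -[|k] /=.
  rewrite cmod0 mul0r; have := hM 0; apply: le_trans.
  by rewrite mulr_ge0 ?cmod_ge0.
apply: le_trans (hM k); rewrite exprS mulrCA -[leRHS]mul1r ler_wpM2r //.
  by rewrite mulr_ge0 ?cmod_ge0 ?exprn_ge0.
exact: ltW.
Qed.

Lemma psum_shift a z : geo a -> cmod z < 1 -> psum (pshift a) z = z * psum a z.
Proof.
move=> ga z1; apply: psumSE.
have -> : (fun n => series (fun k => pshift a k * z ^+ k) n.+1) =
    (fun n => z * series (fun k => a k * z ^+ k) n); last first.
  by apply: cvgMl_tmp; exact: psum_cvg.
apply/funext => n; rewrite /series /= big_nat_recl //= mul0r add0r mulr_sumr.
by apply: eq_bigr => k _; rewrite exprS; ring.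
Qed.

(* Bernoulli: r^k <= s^k / (1 + k d) where s / r = 1 + d. *)
Lemma geo_nat a : geo a -> geo (fun k => k%:R * a k).
Proof.
move=> ga r r0 r1; have [->|rn0] := eqVneq r 0.
  exists 0 => -[|k]; first by rewrite mul0r cmod0 mul0r.
  by rewrite expr0n mulr0.
have {}r0 : 0 < r by rewrite lt_def rn0.
set s := (1 + r) / 2; have rs : r < s by rewrite /s; lra.
have [||M hM] := ga s; [lra|rewrite /s; lra|].
set d := s / r - 1.
have d0 : 0 < d by rewrite subr_gt0 ltr_pdivlMr // mul1r.
have M0 : 0 <= M by have := hM 0; rewrite expr0 mulr1; apply: le_trans; rewrite cmod_ge0.
exists (M / d) => k; rewrite ler_pdivlMr //.
rewrite -toC_nat cmodM cmod_toC ger0_norm //.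
have hB : k%:R * d <= (s / r) ^+ k.
  have : 1 + k%:R * d <= (s / r) ^+ k.
    have -> : s / r = 1 + d by rewrite /d addrC subrK.
    elim: k => [|k IH]; first by rewrite mul0r addr0 expr0.
    rewrite exprS; apply: le_trans (ler_wpM2l _ IH); last by lra.
    rewrite -natr1; have : 0 <= k%:R * (d * d) by rewrite !mulr_ge0 // ltW.
    by lra.
  by lra.
apply: le_trans (hM k).
have -> : s ^+ k = (s / r) ^+ k * r ^+ k by rewrite -exprMn divfK.
rewrite [leLHS](_ : _ = cmod (a k) * (k%:R * d * r ^+ k)); last by ring.
by rewrite ler_wpM2l ?cmod_ge0 // ler_wpM2r // exprn_ge0 // ltW.
Qed.

Definition pderiv a k := k.+1%:R * a k.+1.

Lemma geo_behead a : geo a -> geo (fun k => a k.+1).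
Proof.
move=> ga r r0 r1; have [->|rn0] := eqVneq r 0.
  exists (cmod (a 1%N)) => -[|k]; first by rewrite expr0 mulr1.
  by rewrite expr0n mulr0 cmod_ge0.
have [M hM] := ga _ r0 r1; exists (M / r) => k.
rewrite ler_pdivlMr ?lt_def ?rn0 // -mulrA -exprSr; exact: hM.
Qed.

Lemma geo_deriv a : geo a -> geo (pderiv a).
Proof. by move=> ga; exact: (geo_behead (geo_nat ga)). Qed.

Lemma psum_nat a z : geo a -> cmod z < 1 ->
  psum (fun k => k%:R * a k) z = z * psum (pderiv a) z.
Proof.
move=> ga z1; rewrite -psum_shift //; last exact: geo_deriv.
by congr (psum _ z); apply/funext => -[|k] //=; rewrite mul0r.
Qed.

(** At the real point [r] the terms of the series tend to 0, so they are below 1 from some [N] on;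
    the earlier ones are absorbed by adding their sum to the bound. *)
Lemma geo_of_cvg a : (forall z, cmod z < 1 -> cvgn (series (fun k => a k * z ^+ k))) ->
  geo a.
Proof.
move=> ha r r0 r1.
have /ha /cvg_series_cvg_0 /cvg_cmodP /(_ 1 ltr01) [N _ hN] : cmod (toC r) < 1.
  by rewrite cmod_toC ger0_norm.
exists (1 + \sum_(0 <= k < N) cmod (a k) * r ^+ k) => k.
have tk j : 0 <= cmod (a j) * r ^+ j by rewrite mulr_ge0 ?cmod_ge0 ?exprn_ge0.
have [Nk|kN] := leqP N k.
  apply: ler_wpDr; first by apply: sumr_ge0.
  have := hN k Nk; rewrite sub0r cmodN cmodM cmodX cmod_toC ger0_norm //.
  exact: ltW.
apply: ler_wpDl => //.
rewrite (big_cat_nat _ (n := k.+1)) //= big_nat_recr //= -addrA addrCA lerDl.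
by rewrite addr_ge0 // sumr_ge0.
Qed.

End PowerSeries.

(** * Divided differences of power series *)

Section DividedDifference.
Variable R : realType.
Local Notation C := (Cplx R).
Implicit Types (z w : C) (r s : R) (a b : nat -> C).

Lemma psum_behead a z : geo a -> cmod z < 1 ->
  psum a z = a 0%N + z * psum (fun k => a k.+1) z.
Proof.
move=> ga z1; apply: psumSE.
have -> : (fun n => series (fun k => a k * z ^+ k) n.+1) =
    (fun n => a 0%N + z * series (fun k => a k.+1 * z ^+ k) n).
  apply/funext => n; rewrite /series /= big_nat_recl //= expr0 mulr1 mulr_sumr.
  by congr (_ + _); apply: eq_bigr => k _; rewrite exprS; ring.
apply: cvgD; first exact: cvg_cst.
by apply: cvgMl_tmp; apply: psum_cvg => //; exact: geo_behead.
Qed.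

Lemma geo_drop a n : geo a -> geo (fun k => a (n + k)%N).
Proof.
move=> ga; elim: n => [|n IH]; first by [].
rewrite (_ : (fun _ => _) = (fun k => a (n + k.+1)%N)); first exact: geo_behead IH.
by apply/funext => k; rewrite addSnnS.
Qed.

Definition pconst (c : C) (k : nat) : C := if k is 0 then c else 0.

Lemma geo_const c : geo (pconst c).
Proof.
move=> r r0 r1; exists (cmod c) => -[|k] /=; first by rewrite expr0 mulr1.
by rewrite cmod0 mul0r cmod_ge0.
Qed.

Lemma psum_const c z : cmod z < 1 -> psum (pconst c) z = c.
Proof.
move=> z1; rewrite psum_behead //=; last exact: geo_const.
rewrite (_ : (fun _ => 0) = (fun k => 0 * pconst c k)).
  by rewrite psumZ ?mul0r ?mulr0 ?addr0 //; exact: geo_const.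
by apply/funext => k; rewrite mul0r.
Qed.

(* Coefficients of [w |-> (psum a w - psum a z) / (w - z)]. *)
Definition pdd a z (i : nat) : C := psum (fun j => a (i.+1 + j)%N) z.

Lemma pddS a z i : geo a -> cmod z < 1 ->
  pdd a z i = a i.+1 + z * pdd a z i.+1.
Proof.
move=> ga z1; rewrite /pdd psum_behead //; last exact: geo_drop.
rewrite addn0; congr (_ + _ * psum _ _).
by apply/funext => k; rewrite addnS.
Qed.

Lemma pdd0 a z : geo a -> cmod z < 1 -> psum a z = a 0%N + z * pdd a z 0.
Proof. by move=> ga z1; rewrite psum_behead. Qed.

(** If [M] bounds [|a k| s^k] for some [s] between [max r |z|] and 1, the series defining
    [pdd a z i] is dominated by [M / s^(i+1)] times a geometric series of ratio [|z| / s]. *)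
Lemma geo_pdd a z : geo a -> cmod z < 1 -> geo (pdd a z).
Proof.
move=> ga z1 r r0 r1; have z0 := cmod_ge0 z.
pose s : R := (1 + Num.max r (cmod z)) / 2.
have [rm zm] : r <= Num.max r (cmod z) /\ cmod z <= Num.max r (cmod z).
  by rewrite !le_max !lexx !orbT.
have m1 : Num.max r (cmod z) < 1 by rewrite gt_max r1 z1.
have s0 : 0 < s by rewrite /s; lra.
have s1 : s < 1 by rewrite /s; lra.
have rs : r <= s by rewrite /s; lra.
have zs : cmod z < s by rewrite /s; lra.
clearbody s.
have x1 : cmod z / s < 1 by rewrite ltr_pdivrMr // mul1r.
have x0 : 0 <= cmod z / s by rewrite divr_ge0 // ltW.
have [M hM] := ga s (ltW s0) s1.
exists (M / s / (1 - cmod z / s)) => i.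
apply: (@le_trans _ _ (cmod (pdd a z i) * s ^+ i)).
  by rewrite ler_wpM2l ?cmod_ge0 //; apply: lerXn2r; rewrite ?nnegrE // ltW.
rewrite -ler_pdivlMr ?exprn_gt0 //.
apply: cmod_lim_le (psum_cvg (geo_drop i.+1 ga) z1) => n.
apply: le_trans (ler_cmod_sum _ _) _.
have M0 : 0 <= M by have := hM 0; rewrite expr0 mulr1; apply: le_trans; rewrite cmod_ge0.
apply: (@le_trans _ _ (\sum_(0 <= k < n) M / s ^+ i.+1 * (cmod z / s) ^+ k)).
  apply: ler_sum => k _; rewrite cmodM cmodX (expr_div_n (cmod z)).
  rewrite mulrA ler_pdivlMr ?exprn_gt0 // mulrAC ler_wpM2r ?exprn_ge0 //.
  by rewrite ler_pdivlMr ?exprn_gt0 // -mulrA -exprD addnC; exact: hM.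
rewrite -mulr_sumr exprS [leRHS](_ : _ = M / (s * s ^+ i) * (1 - cmod z / s)^-1).
  by rewrite ler_wpM2l ?sum_geometric_le // divr_ge0 // -exprS exprn_ge0 // ltW.
by rewrite (invfM s); ring.
Qed.

(** No double sum is rearranged: the recursion [pddS] is exactly the coefficientwise form of the
    identity, with [pshift b - z b] standing for multiplication by [w - z]. *)
Lemma psum_dd a z w : geo a -> cmod z < 1 -> cmod w < 1 ->
  psum a w = psum a z + (w - z) * psum (pdd a z) w.
Proof.
move=> ga z1 w1; set b := pdd a z; have gb : geo b by exact: geo_pdd.
have -> : psum a w = psum (fun k => pconst (psum a z) k + (pshift b k + - z * b k)) w.
  congr (psum _ w); apply/funext => -[|k] /=.
    by rewrite add0r (pdd0 ga z1) -/b; ring.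
  by rewrite add0r /b (pddS k ga z1); ring.
have g1 := geo_const (psum a z).
have g2 := geo_shift gb.
have g3 := geoZ (- z) gb.
rewrite psumD //; last exact: geoD.
by rewrite psumD // psum_const // psum_shift // psumZ //; ring.
Qed.

Lemma psum_dd_diag a z : geo a -> cmod z < 1 ->
  psum (pdd a z) z = psum (pderiv a) z.
Proof.
move=> ga z1; apply/esym/psumE; set b := pdd a z.
have gb : geo b by exact: geo_pdd.
rewrite -[psum b z]subr0.
(* Summation by parts with [a (n+1) = b n - z b (n+1)]. The boundary term is a term of the
   convergent series with coefficients [k b k], so it tends to 0. *)
rewrite (_ : series _ = (fun n => series (fun k => b k * z ^+ k) n - n%:R * b n * z ^+ n)).
  apply: cvgB; first exact: psum_cvg.
  exact: cvg_series_cvg_0 (cvgP _ (psum_cvg (geo_nat gb) z1)).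
apply/funext; elim => [|n IH]; first by rewrite /series /= !big_geq // mul0r mul0r subr0.
rewrite /series /= in IH *; rewrite !big_nat_recr //= IH /pderiv.
have -> : a n.+1 = b n - z * b n.+1 by rewrite /b (pddS n ga z1); ring.
by rewrite exprS -natr1; ring.
Qed.

End DividedDifference.

(** * Complex differentiation of power series and Taylor coefficients *)

Section Derivative.
Variable R : realType.
Local Notation C := (Cplx R).
Implicit Types (z w : C) (r s : R) (a b : nat -> C).

(** Caratheodory's form of the derivative: the difference quotient is [h] itself, and the Lipschitz
    bound gives its continuity at [z]. *)
Lemma is_derive_of_factor (f h : C -> C) z (e K : R) : 0 < e ->
  (forall w, cmod (w - z) < e -> f w = f z + (w - z) * h w) ->
  (forall w, cmod (w - z) < e -> cmod (h w - h z) <= K * cmod (w - z)) ->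
  is_derive z 1 f (h z).
Proof.
move=> e0 fh hK.
suff H : (fun t => t^-1 *: ((f \o shift z) (t *: 1) - f z)) @ 0^' --> h z.
  by split; [apply/cvg_ex; exists (h z)|apply: cvg_lim H; exact: norm_hausdorff].
apply/cvg_cmodP => x x0; rewrite near_withinE; apply/nbhs_cmodP.
have K1 : 0 < `|K| + 1 by rewrite ltr_wpDl.
exists (Num.min e (x / (`|K| + 1))); first by rewrite lt_min e0 divr_gt0.
move=> t; rewrite subr0 lt_min => /andP[te tx] tn0 /=.
have tz : t *: 1 + z - z = t by rewrite addrK [_ *: _]mulr1.
have tze : cmod (t *: 1 + z - z) < e by rewrite tz.
rewrite (fh _ tze) addrAC subrr add0r tz [_ *: _]mulrA mulVf // mul1r cmodC.
apply: le_lt_trans (hK _ tze) _; rewrite tz.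
move: tx; rewrite ltr_pdivlMr //; apply: le_lt_trans; rewrite mulrC.
by rewrite ler_wpM2l ?cmod_ge0 // (le_trans (ler_norm _)) // lerDl.
Qed.

Lemma cmod_near_lt1 z w : cmod z < 1 -> cmod (w - z) < (1 - cmod z) / 2 ->
  cmod w < (1 + cmod z) / 2.
Proof. by move=> z1; have := ler_cmodD (w - z) z; rewrite subrK; lra. Qed.

Lemma psum_lip a z : geo a -> cmod z < 1 ->
  exists2 K, 0 <= K & forall w, cmod (w - z) < (1 - cmod z) / 2 ->
    cmod (psum a w - psum a z) <= K * cmod (w - z).
Proof.
move=> ga z1; have z0 := cmod_ge0 z.
have [||K K0 hK] := psum_bounded (geo_pdd ga z1) (r := (1 + cmod z) / 2); [lra|lra|].
exists K => // w /(cmod_near_lt1 z1) wz.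
rewrite (psum_dd ga z1); last by lra.
rewrite addrAC subrr add0r cmodM mulrC ler_wpM2r ?cmod_ge0 //.
by apply: hK; lra.
Qed.

Lemma psum_is_derive a z : geo a -> cmod z < 1 ->
  is_derive z 1 (psum a) (psum (pderiv a) z).
Proof.
move=> ga z1; rewrite -psum_dd_diag //; have z0 := cmod_ge0 z.
have [K _ hK] := psum_lip (geo_pdd ga z1) z1.
apply: (@is_derive_of_factor _ _ _ ((1 - cmod z) / 2) K) => //; first by lra.
move=> w /(cmod_near_lt1 z1) wz.
by rewrite [LHS](psum_dd ga z1) //; lra.
Qed.

Lemma near_disk z (P : C -> Prop) r : cmod z < r ->
  (forall w, cmod w < r -> P w) -> \forall w \near z, P w.
Proof.
move=> zr hP; apply/nbhs_cmodP; exists (r - cmod z); first by lra.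
by move=> w wz; apply: hP; have := ler_cmodD (w - z) z; rewrite subrK; lra.
Qed.

Lemma iter_geo_deriv k a : geo a -> geo (iter k (@pderiv R) a).
Proof. by move=> ga; elim: k => //= k; exact: geo_deriv. Qed.

Lemma derive1n_psum (f : C -> C) a : geo a ->
  (forall z, cmod z < 1 -> f z = psum a z) ->
  forall k z, cmod z < 1 -> derive1n k f z = psum (iter k (@pderiv R) a) z.
Proof.
move=> ga hf; elim=> [|k IH] z z1; first by rewrite derive1n0 hf.
rewrite derive1nS derive1E.
(* The induction hypothesis holds on the open disk only, which suffices because derivatives are
   local. *)
have E : \forall w \near z, psum (iter k (@pderiv R) a) w = derive1n k f w.
  by apply: (near_disk z1) => w w1; rewrite IH.
have := near_eq_is_derive E (psum_is_derive (iter_geo_deriv k ga) z1).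
by move/@derive_val.
Qed.

Lemma iter_pderivE a k j :
  j`!%:R * iter k (@pderiv R) a j = (j + k)`!%:R * a (j + k)%N.
Proof.
elim: k j => [|k IH] j; first by rewrite addn0.
rewrite iterS {1}/pderiv addnS -addSn -IH factS natrM; ring.
Qed.

Lemma taylor_coef_psum (f : C -> C) a k : geo a ->
  (forall z, cmod z < 1 -> f z = psum a z) -> taylor_coef f k = a k.
Proof.
move=> ga hf; rewrite /taylor_coef (derive1n_psum ga hf) ?cmod0 // psum0.
have := iter_pderivE a k 0; rewrite fact0 mul1r add0n => ->.
by rewrite mulrAC divff ?mul1r // pnatr_eq0 -lt0n fact_gt0.
Qed.

Lemma derivable_quotient a b z : geo a -> geo b -> cmod z < 1 ->
  psum b z != 0 -> derivable (fun w => psum a w / psum b w) z 1.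
Proof.
move=> ga gb z1 bz.
have [da _] := psum_is_derive ga z1; have [db _] := psum_is_derive gb z1.
exact: (@derivableM _ _ (psum a) (fun w => (psum b w)^-1) z 1 da (derivableV bz db)).
Qed.

End Derivative.

(** * Second-order expansions of quotients and absence of local maxima *)

Section MaximumPrinciple.
Variable R : realType.
Local Notation C := (Cplx R).
Implicit Types (z w : C) (r s : R) (a b : nat -> C).

(** With [c] the value at [z], the numerator [a - c b] vanishes at [z] and can be divided by
    [w - z]. The denominator stays [b], so the step can be iterated. *)
Lemma quotient_dd a b z : geo a -> geo b ->
  (forall w, cmod w < 1 -> psum b w != 0) -> cmod z < 1 ->
  exists2 a', geo a' & forall w, cmod w < 1 ->
    psum a w / psum b w = psum a z / psum b z + (w - z) * (psum a' w / psum b w).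
Proof.
move=> ga gb b0 z1; set c := psum a z / psum b z.
pose d := fun k => a k + - c * b k.
have gcb : geo (fun k => - c * b k) by exact: geoZ.
have gd : geo d by exact: geoD.
have dE w : cmod w < 1 -> psum d w = psum a w - c * psum b w.
  by move=> w1; rewrite psumD // psumZ // mulNr.
exists (pdd d z); first exact: geo_pdd.
move=> w w1; have := psum_dd gd z1 w1.
rewrite !dE // {2}/c divfK ?b0 // subrr add0r mulrA => <-.
by rewrite mulrBl mulfK ?b0 // addrC subrK.
Qed.

Lemma quotient_bounded a b z : geo a -> geo b -> psum b z != 0 -> cmod z < 1 ->
  exists d K, 0 < d /\ forall w, cmod (w - z) < d ->
    cmod w < 1 /\ cmod (psum a w / psum b w) <= K.
Proof.
move=> ga gb bz z1; have z0 := cmod_ge0 z.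
have [L L0 hL] := psum_lip gb z1.
have [||M M0 hM] := psum_bounded ga (r := (1 + cmod z) / 2); [lra|lra|].
have B0 : 0 < cmod (psum b z) by rewrite cmod_gt0.
have L1 : 0 < 2 * (L + 1) by lra.
(* Within this distance the Lipschitz bound [L] keeps [|psum b w|] above half of [|psum b z|]. *)
exists (Num.min ((1 - cmod z) / 2) (cmod (psum b z) / (2 * (L + 1)))).
exists (M / (cmod (psum b z) / 2)); split.
  by rewrite lt_min !divr_gt0 //; lra.
move=> w; rewrite lt_min => /andP[wz]; rewrite ltr_pdivlMr // => wb.
have w1 := cmod_near_lt1 z1 wz; split; first by lra.
have bw : cmod (psum b z) / 2 <= cmod (psum b w).
  have := hL _ wz; have := ler_cmodD (psum b z - psum b w) (psum b w).
  by rewrite subrK cmodC; have := cmod_ge0 (w - z); nra.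
have B2 : 0 < cmod (psum b z) / 2 by lra.
rewrite cmodM cmodV ler_pM ?cmod_ge0 ?invr_ge0 ?cmod_ge0 //.
  by apply: hM; lra.
by rewrite lef_pV2 // posrE // (lt_le_trans B2).
Qed.

Lemma quotient_taylor2 a b z : geo a -> geo b ->
  (forall w, cmod w < 1 -> psum b w != 0) -> cmod z < 1 ->
  exists (f1 f2 : C) (d K : R), 0 < d /\ forall h, cmod h < d ->
    cmod (z + h) < 1 /\
    cmod (psum a (z + h) / psum b (z + h) -
          (psum a z / psum b z + f1 * h + f2 * h ^+ 2)) <= K * cmod h ^+ 3.
Proof.
move=> ga gb b0 z1.
have [a1 ga1 h1] := quotient_dd ga gb b0 z1.
have [a2 ga2 h2] := quotient_dd ga1 gb b0 z1.
have [a3 ga3 h3] := quotient_dd ga2 gb b0 z1.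
have [d [K [d0 hK]]] := quotient_bounded ga3 gb (b0 _ z1) z1.
exists (psum a1 z / psum b z), (psum a2 z / psum b z), d, K; split => // h hd.
have zh : z + h - z = h by rewrite addrC addKr.
have [|zh1 hb] := hK (z + h); first by rewrite zh.
split => //; rewrite h1 // h2 // h3 // zh.
set q := psum a3 _ / _ in hb *.
rewrite [X in cmod X](_ : _ = q * h ^+ 3); last by ring.
by rewrite cmodM cmodX ler_wpM2r // exprn_ge0 // cmod_ge0.
Qed.

(* Averaging over the four points [z +- t], [z +- i t] cancels the terms of
   degree 1 and 2 of [f], while [e |z|^2] gains [e t^2]. *)
Lemma no_local_max (f : C -> C) z (f1 f2 : C) (d K e : R) : 0 < d -> 0 < e ->
  (forall h, cmod h < d ->
    cmod (f (z + h) - (f z + f1 * h + f2 * h ^+ 2)) <= K * cmod h ^+ 3) ->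
  ~ (forall h, cmod h < d -> cmod (f (z + h)) ^+ 2 + e * cmod (z + h) ^+ 2 <=
      cmod (f z) ^+ 2 + e * cmod z ^+ 2).
Proof.
move=> d0 e0 hE hmax.
pose F := cmod (f z); have F0 : 0 <= F by exact: cmod_ge0.
have G0 : 0 < 4 * F * `|K| + 1 by rewrite ltr_wpDl // !mulr_ge0.
(* Small enough for the cubic remainders, which cost at most [16 F |K| t^3] in the sum of the four
   squared moduli, to lose against the gain [4 e t^2]. *)
pose t := Num.min (d / 2) (e / (4 * F * `|K| + 1)).
have t0 : 0 < t by rewrite lt_min !divr_gt0.
have td : t < d.
  by apply: le_lt_trans (_ : d / 2 < d); [rewrite ge_min lexx|lra].
have te : 4 * F * `|K| * t < e.
  have : t <= e / (4 * F * `|K| + 1) by rewrite ge_min lexx orbT.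
  by rewrite ler_pdivlMr // mulrDr mulr1 mulrC; lra.
clearbody t.
pose I : C := (0 +i* 1)%C.
have II : I * I = -1 by apply: ReIm_eq; rewrite ?ReCM ?ImCM /=; ring.
have [RI II1] : complex.Re I = 0 /\ complex.Im I = 1 by [].
pose E h := f (z + h) - (f z + f1 * h + f2 * h ^+ 2).
have cI : cmod I = 1.
  apply/eqP; rewrite -(@eqrXn2 _ 2) ?cmod_ge0 ?ler01 // cmod_ReIm /=.
  by rewrite expr0n expr1n add0r.
clearbody I.
have c1 : cmod (toC t) = t by rewrite cmod_toC gtr0_norm.
have c2 : cmod (- toC t) = t by rewrite cmodN.
have c3 : cmod (I * toC t) = t by rewrite cmodM cI mul1r.
have c4 : cmod (- (I * toC t)) = t by rewrite cmodN.
have hEt h : cmod h = t -> cmod (E h) <= `|K| * t ^+ 3.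
  move=> ht; rewrite -ht; apply: le_trans (hE _ _) _; first by rewrite ht.
  by rewrite ler_wpM2r ?exprn_ge0 ?cmod_ge0 // ler_norm.
have e1 := hEt _ c1; have e2 := hEt _ c2; have e3 := hEt _ c3; have e4 := hEt _ c4.
have m1 := hmax (toC t); have m2 := hmax (- toC t).
have m3 := hmax (I * toC t); have m4 := hmax (- (I * toC t)).
rewrite c1 in m1; rewrite c2 in m2; rewrite c3 in m3; rewrite c4 in m4.
move: (m1 td) (m2 td) (m3 td) (m4 td) => {m1 m2 m3 m4}.
set w1 := f (z + toC t); set w2 := f (z + - toC t).
set w3 := f (z + I * toC t); set w4 := f (z + - (I * toC t)).
pose S := E (toC t) + E (- toC t) + E (I * toC t) + E (- (I * toC t)).
have SE : w1 + w2 + w3 + w4 = f z + f z + f z + f z + S.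
  rewrite /S /E -/w1 -/w2 -/w3 -/w4 !sqrrN exprMn [I ^+ 2]II; ring.
have Sb : cmod S <= 4 * `|K| * t ^+ 3.
  rewrite /S; apply: le_trans (ler_cmodD _ _) _.
  have := ler_cmodD (E (toC t) + E (- toC t)) (E (I * toC t)).
  have := ler_cmodD (E (toC t)) (E (- toC t)); lra.
have ReS : complex.Re w1 + complex.Re w2 + complex.Re w3 + complex.Re w4 =
    4 * complex.Re (f z) + complex.Re S.
  by rewrite -!ReCD SE !ReCD; ring.
have ImS : complex.Im w1 + complex.Im w2 + complex.Im w3 + complex.Im w4 =
    4 * complex.Im (f z) + complex.Im S.
  by rewrite -!ImCD SE !ImCD; ring.
rewrite !cmod_ReIm !ReCD !ImCD !ReCN !ImCN. 
rewrite (ReCM I) (ImCM I) RI II1 /=.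
have Rb : - (F * (4 * `|K| * t ^+ 3)) <= complex.Re (f z) * complex.Re S.
  rewrite lerNl; apply: le_trans (ler_norm _) _; rewrite normrN normrM.
  by rewrite ler_pM // ?ler_Re_cmod // (le_trans (ler_Re_cmod _)).
have Ib : - (F * (4 * `|K| * t ^+ 3)) <= complex.Im (f z) * complex.Im S.
  rewrite lerNl; apply: le_trans (ler_norm _) _; rewrite normrN normrM.
  by rewrite ler_pM // ?ler_Im_cmod // (le_trans (ler_Im_cmod _)).
have T0 : 0 < t ^+ 2 by rewrite exprn_gt0.
have key : 4 * (4 * F * `|K| * t) * t ^+ 2 < 4 * e * t ^+ 2.
  by rewrite ltr_pM2r //; lra.
have t3 : 4 * (4 * F * `|K| * t) * t ^+ 2 = 4 * (F * (4 * `|K| * t ^+ 3)) by ring.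
rewrite {}t3 in key.
move: (F * _) key Rb Ib => Q key Rb Ib.
(* Bounding each square below by its tangent at the value of [f z] leaves a linear expression, in
   which only the sum of the four values enters. *)
have sq (x y : R) : 2 * x * y - x ^+ 2 <= y ^+ 2.
  by rewrite -subr_ge0; have := sqr_ge0 (x - y); rewrite sqrrB; lra.
set p := complex.Re (f z) in ReS Rb *; set q := complex.Im (f z) in ImS Ib *.
have := sq p (complex.Re w1); have := sq p (complex.Re w2).
have := sq p (complex.Re w3); have := sq p (complex.Re w4).
have := sq q (complex.Im w1); have := sq q (complex.Im w2).
have := sq q (complex.Im w3); have := sq q (complex.Im w4).
have pR : p * complex.Re w1 + p * complex.Re w2 + p * complex.Re w3 + p * complex.Re w4 =
    4 * p ^+ 2 + p * complex.Re S by rewrite -!mulrDr ReS; ring.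
have qI : q * complex.Im w1 + q * complex.Im w2 + q * complex.Im w3 + q * complex.Im w4 =
    4 * q ^+ 2 + q * complex.Im S by rewrite -!mulrDr ImS; ring.
move: (complex.Re z) (complex.Im z) => x y.
lra.
Qed.

End MaximumPrinciple.

(** * Compactness of closed disks and the maximum modulus principle *)

Section MaximumModulus.
Variable R : realType.
Local Notation C := (Cplx R).
Implicit Types (z w : C) (r s : R) (a b : nat -> C).

Lemma cvg_cmod {T : Type} (F : set_system T) (FF : Filter F) (u : T -> C) (l : C) :
  u @ F --> l -> (fun t => cmod (u t)) @ F --> cmod l.
Proof.
move=> /cvg_cmodP hu; apply/cvgrPdist_lt => e e0.
apply: filterS (hu _ e0) => t; apply: le_lt_trans.
rewrite ler_norml; apply/andP; split.
  by have := ler_cmodD (u t - l) l; rewrite subrK cmodC; lra.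
by have := ler_cmodD (l - u t) (u t); rewrite subrK; lra.
Qed.

Lemma psum_continuous a z : geo a -> cmod z < 1 -> psum a w @[w --> z] --> psum a z.
Proof.
move=> ga z1; have [da _] := psum_is_derive ga z1.
exact/differentiable_continuous/derivable1_diffP.
Qed.

(** Carries compactness over from the product of two real segments. *)
Definition mkC (p : R * R) : C := (p.1 +i* p.2)%C.

Lemma mkC_continuous : continuous mkC.
Proof.
move=> p; apply/cvg_cmodP => e e0; have e2 : 0 < e / 2 by lra.
have h1 : fst q @[q --> p] --> p.1 by exact: cvg_fst.
have h2 : snd q @[q --> p] --> p.2 by exact: cvg_snd.
move/cvgrPdist_lt : h1 => /(_ _ e2); move/cvgrPdist_lt : h2 => /(_ _ e2).
apply: filterS2 => q hq2 hq1; apply: le_lt_trans (ler_cmod_ReIm _) _.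
by rewrite ReCD ImCD ReCN ImCN /= (splitr e) ltrD.
Qed.

Lemma compact_closed_disk r : compact [set p | cmod (mkC p) <= r].
Proof.
apply: (@subclosed_compact _ _ (`[- r, r]%classic `*` `[- r, r]%classic)).
- apply: (@closed_comp _ _ (fun p => cmod (mkC p)) [set x | x <= r]).
    by move=> p _; apply: cvg_cmod; exact: mkC_continuous.
  exact: closed_le.
- by apply: compact_setX; exact: segment_compact.
- move=> p /= pr; rewrite !in_itv /= -!ler_norml; split.
    exact: le_trans (ler_Re_cmod (mkC p)) pr.
  exact: le_trans (ler_Im_cmod (mkC p)) pr.
Qed.

Lemma mkC_ReIm z : mkC (complex.Re z, complex.Im z) = z.
Proof. exact: ReIm_eq. Qed.

Lemma max_closed_disk (u : C -> R) r : 0 <= r ->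
  (forall z, cmod z <= r -> u w @[w --> z] --> u z) ->
  exists2 z, cmod z <= r & forall w, cmod w <= r -> u w <= u z.
Proof.
move=> r0 hu; pose A := [set p | cmod (mkC p) <= r].
have [||p pA hp] := @compact_EVT_max _ R (u \o mkC) A _ (@compact_closed_disk r).
- by exists (0, 0); rewrite /A /= (_ : mkC _ = 0) ?cmod0 //; exact: ReIm_eq.
- apply: continuous_in_subspaceT => p; rewrite inE => pA.
  by apply: (continuous_comp (@mkC_continuous p)); exact: hu.
exists (mkC p); first by rewrite inE in pA.
move=> w wr; have := hp (complex.Re w, complex.Im w).
by rewrite /= mkC_ReIm; apply; rewrite inE /A /= mkC_ReIm.
Qed.

(** Suppose [|f|^2] exceeds [K] at [z1], and let [e] be half the excess. Then [|f|^2 + e |z|^2] is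
    at least [K + 2 e] at [z1] but at most [K + e] on the circle, so its maximum over the closed
    disk is interior, which [no_local_max] forbids. *)
Lemma maximum_principle a b r K : geo a -> geo b ->
  (forall z, cmod z < 1 -> psum b z != 0) -> 0 < r -> r < 1 ->
  (forall z, cmod z = r -> cmod (psum a z / psum b z) ^+ 2 <= K) ->
  forall z, cmod z <= r -> cmod (psum a z / psum b z) ^+ 2 <= K.
Proof.
move=> ga gb b0 r0 r1 hK z1 z1r; rewrite leNgt; apply/negP => Kz.
pose f z := psum a z / psum b z.
pose e := (cmod (f z1) ^+ 2 - K) / 2.
have e0 : 0 < e by rewrite /e /f; lra.
pose u z := cmod (f z) ^+ 2 + e * cmod z ^+ 2.
have [||z zr hz] := @max_closed_disk u r; first exact: ltW.
  move=> z zr; have z1' : cmod z < 1 by lra.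
  have cf : f w @[w --> z] --> f z.
    exact: (cvgM (psum_continuous ga z1')
                 (cvgV (b0 _ z1') (psum_continuous gb z1'))).
  have cn := cvg_cmod (nbhs_filter z) cf.
  have ci := cvg_cmod (nbhs_filter z) (@cvg_id _ (nbhs z)).
  exact: (cvgD (cvgM cn cn) (cvgM (cvg_cst e) (cvgM ci ci))).
have sq w : cmod w <= r -> e * cmod w ^+ 2 <= e.
  move=> wr; rewrite -[leRHS]mulr1 ler_wpM2l ?(ltW e0) //.
  by rewrite expr_le1 ?cmod_ge0 // (le_trans wr) // ltW.
have big : K + e < u z.
  have := hz _ z1r; rewrite /u.
  have : 0 <= e * cmod z1 ^+ 2 by rewrite mulr_ge0 ?sqr_ge0 // ltW.
  by rewrite /e; lra.
have [zeq|zne] := eqVneq (cmod z) r.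
  by have := hK _ zeq; have := sq _ zr; rewrite /u in big *; rewrite -/(f z); lra.
have zlt : cmod z < r by rewrite lt_neqAle zne.
have z11 : cmod z < 1 by lra.
have [f1 [f2 [d [M [d0 hd]]]]] := quotient_taylor2 ga gb b0 z11.
apply: (@no_local_max _ f z f1 f2 (Num.min d (r - cmod z)) M e) => //.
- by rewrite lt_min d0; lra.
- by move=> h; rewrite lt_min => /andP[hh _]; have [] := hd _ hh.
- move=> h; rewrite lt_min => /andP[_ hh]; apply: hz.
  by have := ler_cmodD z h; lra.
Qed.

End MaximumModulus.

(** * Schwarz-Pick and Harnack inequalities for a half-plane *)

Section SchwarzPick.
Variable R : realType.
Local Notation C := (Cplx R).
Implicit Types (z w : C) (r s : R) (a b : nat -> C).

Definition cconj z : C := (complex.Re z -i* complex.Im z)%C.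

(** Measures how far the Blaschke factor of [z] is from being unimodular on a circle
    [|w| = r < 1]. *)
Lemma mobius_identity z w : cmod (1 - cconj z * w) ^+ 2 =
  cmod (w - z) ^+ 2 + (1 - cmod z ^+ 2) * (1 - cmod w ^+ 2).
Proof. by rewrite !cmod_ReIm !ReCD !ImCD !ReCN !ImCN ReCM ImCM /=; ring. Qed.

(* [w |-> (w - v) / (w + conj v - 2 k)] maps the half-plane [Re w > k] into the
   unit disk. *)
Lemma cayley_le (v w : C) k : k < complex.Re v -> k < complex.Re w ->
  cmod (w - v) <= cmod (w + (cconj v - toC (2 * k))).
Proof.
move=> vk wk; rewrite -(@ler_pXn2r _ 2) ?nnegrE ?cmod_ge0 //.
rewrite !cmod_ReIm !ReCD !ImCD !ReCN !ImCN /= -subr_ge0.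
have : 0 <= 4 * ((complex.Re w - k) * (complex.Re v - k)).
  by rewrite mulr_ge0 // mulr_ge0 // subr_ge0 ltW.
by lra.
Qed.

Lemma cayley_denom_neq0 (v w : C) k : k < complex.Re v -> k < complex.Re w ->
  w + (cconj v - toC (2 * k)) != 0.
Proof.
move=> vk wk; apply/eqP => /(congr1 (@complex.Re R)).
by rewrite !ReCD ReCN /=; lra.
Qed.

(** The limit [r -> 1] made explicit with [r = 1 - d]: [g] keeps [r - m] away from 0, and [d] is so
    small that the error [2 c d / g^2] stays below [x - 1]. *)
Lemma le1_of_radii (x m : R) (c : R) : 0 <= c -> m < 1 -> 0 <= m ->
  (forall r, m < r -> r < 1 -> x <= 1 + c * (1 - r ^+ 2) / (r - m) ^+ 2) -> x <= 1.
Proof.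
move=> c0 m1 m0 h; rewrite leNgt; apply/negP => x1.
pose g := (1 - m) / 2; have g0 : 0 < g by rewrite /g; lra.
pose d := Num.min g ((x - 1) * g ^+ 2 / (2 * c + 1)).
have d0 : 0 < d by rewrite lt_min g0 divr_gt0 ?mulr_gt0 ?exprn_gt0 //; lra.
have dg : d <= g by rewrite ge_min lexx.
have dx : d <= (x - 1) * g ^+ 2 / (2 * c + 1) by rewrite ge_min lexx orbT.
clearbody d.
have c1 : 0 < 2 * c + 1 by lra.
rewrite ler_pdivlMr // in dx.
have [gr dm d1] : [/\ g <= 1 - d - m, m < 1 - d & 1 - d < 1].
  by move: dg; rewrite /g => dg; split; lra.
have := h _ dm d1; apply/negP; rewrite -ltNge.
rewrite -ltrBrDl ltr_pdivrMr; last by rewrite exprn_gt0 // (lt_le_trans g0).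
have gg : (x - 1) * g ^+ 2 <= (x - 1) * (1 - d - m) ^+ 2.
  by rewrite ler_wpM2l; [|lra|apply: lerXn2r; rewrite ?nnegrE; lra].
apply: lt_le_trans gg; apply: lt_le_trans dx.
have : 0 <= c * d ^+ 2 by rewrite mulr_ge0 ?sqr_ge0.
have -> : c * (1 - (1 - d) ^+ 2) = 2 * c * d - c * d ^+ 2 by ring.
by rewrite mulrDr mulr1; lra.
Qed.

(** Schwarz lemma for the Cayley transform of [psum a / psum b] centred at its value at [z]. The
    series [n] is the divided difference at [z] of [psum b z * a - psum a z * b]; keeping it instead
    of a quotient by [w - z] lets the inequality be read at [w = z] as well. *)
Lemma schwarz_pick a b k z : geo a -> geo b ->
  (forall w, cmod w < 1 -> psum b w != 0) ->
  (forall w, cmod w < 1 -> k < complex.Re (psum a w / psum b w)) ->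
  cmod z < 1 ->
  exists n, [/\ geo n,
    forall w, cmod w < 1 ->
      psum b z * psum a w - psum a z * psum b w = (w - z) * psum n w,
    psum n z = psum b z * psum (pderiv a) z - psum a z * psum (pderiv b) z &
    forall w, cmod w < 1 ->
      cmod (1 - cconj z * w) * cmod (psum n w) <=
      cmod (psum b z) * cmod (psum a w +
        (cconj (psum a z / psum b z) - toC (2 * k)) * psum b w)].
Proof.
move=> ga gb b0 hk z1; have zz0 := cmod_ge0 z.
pose m := fun k => psum b z * a k + - psum a z * b k.
have gba : geo (fun k => psum b z * a k) by exact: geoZ.
have gab : geo (fun k => - psum a z * b k) by exact: geoZ.
have gm : geo m by exact: geoD.
have mE w : cmod w < 1 -> psum m w = psum b z * psum a w - psum a z * psum b w.
  by move=> w1; rewrite psumD // !psumZ // mulNr.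
have gn := geo_pdd gm z1; pose n := pdd m z.
have nE w : cmod w < 1 ->
    psum b z * psum a w - psum a z * psum b w = (w - z) * psum n w.
  move=> w1; rewrite -mE // (psum_dd gm z1 w1) mE //.
  by rewrite mulrC subrr add0r.
exists n; split => //.
  rewrite psum_dd_diag //.
  rewrite (_ : pderiv m =
      (fun k => psum b z * pderiv a k + - psum a z * pderiv b k)).
    have gda := geo_deriv ga; have gdb := geo_deriv gb.
    by rewrite psumD ?psumZ ?mulNr //; exact: geoZ.
  by apply/funext => i; rewrite /pderiv /m; ring.
pose c : C := cconj (psum a z / psum b z) - toC (2 * k).
(* Numerator and denominator of the Cayley transform divided by [(w - z) / (1 - cconj z * w)], as
   coefficient sequences; the maximum principle is applied to their quotient. *)
pose N := fun i => n i + - cconj z * pshift n i.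
pose D := fun i => psum b z * (a i + c * b i).
have gsn : geo (pshift n) by exact: geo_shift.
have gzn : geo (fun i => - cconj z * pshift n i) by exact: geoZ.
have gN : geo N by exact: geoD.
have gcb : geo (fun i => c * b i) by exact: geoZ.
have gac : geo (fun i => a i + c * b i) by exact: geoD.
have gD : geo D by exact: geoZ.
have NE w : cmod w < 1 -> psum N w = (1 - cconj z * w) * psum n w.
  by move=> w1; rewrite psumD // psumZ // psum_shift //; ring.
have DE w : cmod w < 1 -> psum D w = psum b z * (psum a w + c * psum b w).
  by move=> w1; rewrite psumZ // psumD // psumZ.
have DQ w : cmod w < 1 ->
    psum D w = psum b z * psum b w * (psum a w / psum b w + c).
  move=> w1; rewrite DE //; have := b0 _ w1.
  by move: (psum b w) (psum a w) => B A B0; field.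
have D0 w : cmod w < 1 -> psum D w != 0.
  by move=> w1; rewrite DQ // !mulf_neq0 ?b0 // cayley_denom_neq0 ?hk.
suff H w : cmod w < 1 -> cmod (psum N w / psum D w) ^+ 2 <= 1.
  move=> w w1; rewrite -!cmodM -NE // -DE //.
  have := H w w1; rewrite expr_le1 ?cmod_ge0 // cmodM cmodV.
  by rewrite ler_pdivrMr ?cmod_gt0 ?D0 // mul1r.
(* Circles of radius [r > M] enclose [w] and stay at distance at least [r - M] from [z]. *)
move=> w1; pose M := Num.max (cmod w) (cmod z).
have M1 : M < 1 by rewrite gt_max w1.
have [wM zM] : cmod w <= M /\ cmod z <= M by rewrite !le_max !lexx orbT.
have M0 : 0 <= M by apply: le_trans zM.
clearbody M.
apply: (@le1_of_radii _ M (1 - cmod z ^+ 2)) => //.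
  by rewrite subr_ge0 expr_le1 // ltW.
move=> r Mr r1; have r0 : 0 < r by lra.
apply: (maximum_principle gN gD D0 r0 r1); last by lra.
move=> v vr; have v1 : cmod v < 1 by lra.
have vz : r - M <= cmod (v - z).
  by have := ler_cmodD (v - z) z; rewrite subrK; lra.
have vz0 : v - z != 0 by rewrite -cmod_gt0; lra.
(* On the circle the second factor has modulus at most 1 by [cayley_le], and the first is controlled
   by [mobius_identity]. *)
have -> : psum N v / psum D v = (1 - cconj z * v) / (v - z) *
    ((psum a v / psum b v - psum a z / psum b z) / (psum a v / psum b v + c)).
  rewrite NE // DQ //.
  have -> : psum n v = (psum b z * psum a v - psum a z * psum b v) / (v - z).
    by rewrite nE // mulrAC divff // mul1r.
  have := b0 _ v1; have := b0 _ z1.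
  have : psum a v / psum b v + c != 0 by rewrite cayley_denom_neq0 ?hk.
  move: (psum a v) (psum b v) (psum a z) (psum b z) => A B A' B' h1 h2 h3.
  set h := A / B + c in h1 *.
  have -> : A / B - A' / B' = (B' * A - A' * B) / (B' * B).
    by field; rewrite h2 h3.
  move: (B' * A - A' * B) => X; clearbody h.
  by field; rewrite h1 h2 h3 vz0.
rewrite cmodM exprMn.
have c2 : cmod ((psum a v / psum b v - psum a z / psum b z) /
    (psum a v / psum b v + c)) ^+ 2 <= 1.
  rewrite expr_le1 ?cmod_ge0 // cmodM cmodV.
  by rewrite ler_pdivrMr ?cmod_gt0 ?cayley_denom_neq0 ?hk // mul1r cayley_le ?hk.
apply: le_trans (ler_wpM2l (sqr_ge0 _) c2) _; rewrite mulr1.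
rewrite cmodM cmodV exprMn exprVn mobius_identity vr.
have V0 : 0 < cmod (v - z) ^+ 2 by rewrite exprn_gt0 // cmod_gt0.
rewrite mulrDl divff ?gt_eqF // lerD2l ler_wpM2l //.
  by rewrite mulr_ge0 // subr_ge0 expr_le1 ?cmod_ge0 // ltW.
rewrite lef_pV2 ?posrE // ?exprn_gt0 //; last by lra.
by apply: lerXn2r; rewrite ?nnegrE ?cmod_ge0 //; lra.
Qed.

Lemma schwarz_pick_diag a b k z : geo a -> geo b ->
  (forall w, cmod w < 1 -> psum b w != 0) ->
  (forall w, cmod w < 1 -> k < complex.Re (psum a w / psum b w)) ->
  cmod z < 1 ->
  (1 - cmod z ^+ 2) *
    cmod (psum b z * psum (pderiv a) z - psum a z * psum (pderiv b) z) <=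
  2 * (complex.Re (psum a z / psum b z) - k) * cmod (psum b z) ^+ 2.
Proof.
move=> ga gb b0 hk z1.
have [n [gn _ <- /(_ z z1)]] := schwarz_pick ga gb b0 hk z1.
have -> : 1 - cconj z * z = toC (1 - cmod z ^+ 2).
  by rewrite cmod_ReIm; apply: ReIm_eq;
    rewrite ?ReCD ?ImCD ?ReCN ?ImCN ?ReCM ?ImCM /=; ring.
rewrite cmod_toC ger0_norm; last by rewrite subr_ge0 expr_le1 ?cmod_ge0 // ltW.
move=> /le_trans; apply.
(* At [w = z] the Cayley denominator is [Q + cconj Q - 2 k], a real number. *)
rewrite (_ : psum a z + _ = toC (2 * (complex.Re (psum a z / psum b z) - k)) * psum b z).
  rewrite cmodM cmod_toC ger0_norm; first by rewrite expr2 mulrCA.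
  by rewrite mulr_ge0 // subr_ge0 ltW // hk.
set Q := psum a z / psum b z.
have -> : psum a z = Q * psum b z by rewrite divfK ?b0.
rewrite -mulrDl; congr (_ * _).
by apply: ReIm_eq; rewrite ?ReCD ?ImCD ?ReCN ?ImCN /=; ring.
Qed.

(** Schwarz-Pick centred at 0, where the quotient is 1, gives [|Q - 1| <= |z| |Q + 1 - 2 k|]. This
    confines [Q] to a disk, and the bound is the leftmost point of that disk. *)
Lemma Re_quotient_ge a b k z : geo a -> geo b -> a 0%N = 1 -> b 0%N = 1 ->
  (forall w, cmod w < 1 -> psum b w != 0) ->
  (forall w, cmod w < 1 -> k < complex.Re (psum a w / psum b w)) ->
  cmod z < 1 ->
  (1 - k) * (1 - cmod z) <=
    (complex.Re (psum a z / psum b z) - k) * (1 + cmod z).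
Proof.
move=> ga gb a1 b1 b0 hk z1; have zz0 := cmod_ge0 z.
have o1 : cmod (0 : C) < 1 by rewrite cmod0.
have [n [gn nE _ /(_ z z1)]] := schwarz_pick ga gb b0 hk o1.
have := nE z z1; rewrite !psum0 a1 b1 !mul1r subr0 invr1 => nz.
rewrite cmod1 mul1r => h.
have k1 : k < 1 by have := hk 0 o1; rewrite !psum0 a1 b1 divr1.
set Q := psum a z / psum b z.
have QE : psum a z = Q * psum b z by rewrite divfK ?b0.
have B0 : 0 < cmod (psum b z) by rewrite cmod_gt0 b0.
have {}h : cmod (Q - 1) <= cmod z * cmod (Q + (1 - toC (2 * k))).
  rewrite -(ler_pM2r B0) -mulrA -(cmodM (Q - 1)) -(cmodM (Q + _)) !(mulrDl Q) -QE.
  rewrite mulN1r nz (cmodM z) ler_wpM2l //; move: h.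
  have -> : 1 - cconj 0 * z = 1.
    by apply: ReIm_eq; rewrite ?ReCD ?ImCD ?ReCN ?ImCN ?ReCM ?ImCM /=; ring.
  have -> : cconj 1 = 1 by apply: ReIm_eq; rewrite /= ?oppr0.
  by rewrite cmod1 mul1r.
move: h; rewrite -(@ler_pXn2r _ 2) ?nnegrE ?mulr_ge0 ?cmod_ge0 // exprMn.
rewrite (cmod_ReIm (Q - 1)) (cmod_ReIm (Q + _)) !ReCD !ImCD !ReCN !ImCN /=.
have := hk _ z1; rewrite -/Q.
move: (complex.Re Q) (complex.Im Q) (cmod z) zz0 z1 => x y r r0 r1 xk h.
(* The negated bound says [r (x + 1 - 2 k) < 1 - x] with nonnegative left side. Squaring contradicts
   [h], since the [y] terms only help. *)
rewrite leNgt; apply/negP => hlt.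
have u0 : 0 <= r * (x + (1 - 2 * k)) by rewrite mulr_ge0 //; lra.
have : (r * (x + (1 - 2 * k))) ^+ 2 < (1 - x) ^+ 2.
  by rewrite ltr_pXn2r ?nnegrE //; lra.
have : 0 <= (1 - r ^+ 2) * y ^+ 2.
  by rewrite mulr_ge0 ?sqr_ge0 // subr_ge0 expr_le1 // ltW.
rewrite exprMn; lra.
Qed.

End SchwarzPick.

(** * The radius as a root of a quadratic *)

Section Radius.
Variable R : realType.
Implicit Types (kappa lam r : R).

(** The larger reciprocal root of [(1 - r) (1 - (1 - 2 kappa) r) - 2 lam r]. Reciprocals survive at
    [kappa = 1/2], where the polynomial drops to degree 1 and the other one becomes 0. *)
Definition radius_den kappa lam : R :=
  1 - kappa + lam + Num.sqrt ((kappa - lam) ^+ 2 + 2 * lam).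

Lemma sqrt_radicand kappa lam : 0 < lam ->
  Num.sqrt ((kappa - lam) ^+ 2 + 2 * lam) ^+ 2 = (kappa - lam) ^+ 2 + 2 * lam.
Proof. by move=> l0; rewrite sqr_sqrtr // addr_ge0 ?sqr_ge0 //; lra. Qed.

Lemma radius_den_gt1 kappa lam : 0 < lam -> 1 < radius_den kappa lam.
Proof.
move=> l0; have := sqrt_radicand kappa l0; rewrite /radius_den.
move: (Num.sqrt _) (sqrtr_ge0 ((kappa - lam) ^+ 2 + 2 * lam)) => d d0 dE.
suff : kappa - lam < d by lra.
have [h|h] := ltP (kappa - lam) 0; first by lra.
by rewrite -(@ltr_pXn2r _ 2) ?nnegrE // dE; lra.
Qed.

(* The rationalised form [1 / (s + d)] of the smaller root [(s - d) / (s^2 - d^2)]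
   covers both cases of the definition. *)
Lemma sharp_radiusE (p : nat) (alpha beta mu kappa : R) :
  0 < beta -> 0 < alpha + p%:R * beta -> 0 < mu ->
  sharp_radius p alpha beta mu kappa =
  (radius_den kappa (mu * (beta / (alpha + p%:R * beta))))^-1.
Proof.
move=> b0; rewrite /sharp_radius; move: (alpha + _) => c c0 m0.
set lam := mu * (beta / c).
have mbE : mu * beta = c * lam by rewrite /lam; field; rewrite gt_eqF.
have l0 : 0 < lam by rewrite !mulr_gt0 ?invr_gt0.
rewrite -(mulrA 2) mbE; clearbody lam.
have -> : (c * kappa - c * lam) ^+ 2 + 2 * (c * lam) * c =
    c ^+ 2 * ((kappa - lam) ^+ 2 + 2 * lam) by ring.
rewrite sqrtrM ?sqr_ge0 // sqrtr_sqr gtr0_norm //.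
have D1 := radius_den_gt1 kappa l0; have dE := sqrt_radicand kappa l0.
rewrite /radius_den in D1 *; case: ifPn => [/eqP k2|k2].
  have -> : (kappa - lam) ^+ 2 + 2 * lam = (1 - kappa + lam) ^+ 2.
    by rewrite k2; field.
  rewrite sqrtr_sqr ger0_norm; last by rewrite k2; lra.
  have cl : 0 < c * lam by rewrite mulr_gt0.
  by rewrite k2; field; apply/andP; split; rewrite gt_eqF //; lra.
move: (Num.sqrt _) D1 dE => d D1 dE.
have q0 : 1 - 2 * kappa != 0.
  by apply/eqP => q; case/eqP: k2; lra.
have D0 : 1 - kappa + lam + d != 0 by rewrite gt_eqF //; lra.
have q1 : c * (1 - 2 * kappa) != 0 by rewrite mulf_neq0 // gt_eqF.
apply: (mulIf q1); rewrite divfK //; apply: (mulIf D0); rewrite mulrAC mulVf // mul1r.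
transitivity (c * ((1 - kappa + lam) ^+ 2 - d ^+ 2)); first by ring.
by rewrite dE; ring.
Qed.

Lemma radius_quadratic kappa lam r : 0 < lam ->
  (1 - r) * (1 - (1 - 2 * kappa) * r) - 2 * lam * r =
  (1 - radius_den kappa lam * r) *
  (1 - (2 * (1 - kappa + lam) - radius_den kappa lam) * r).
Proof.
move=> l0; have := sqrt_radicand kappa l0; rewrite /radius_den.
move: (Num.sqrt _) => d dE.
transitivity ((1 - (1 - kappa + lam) * r) ^+ 2 - d ^+ 2 * r ^+ 2); last by ring.
by rewrite dE; ring.
Qed.

Lemma radius_quadratic_gt0 kappa lam r : 0 < lam -> 0 <= r ->
  r < (radius_den kappa lam)^-1 ->
  2 * lam * r < (1 - r) * (1 - (1 - 2 * kappa) * r).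
Proof.
move=> l0 r0; have D1 := radius_den_gt1 kappa l0.
rewrite -[X in _ < X]div1r ltr_pdivlMr; last by lra.
rewrite mulrC => rD; rewrite -subr_gt0 radius_quadratic //.
rewrite mulr_gt0 ?subr_gt0 //; apply: le_lt_trans rD.
(* The other reciprocal root is smaller by twice the square root, so its factor is positive too. *)
rewrite ler_wpM2r // /radius_den.
by have := sqrtr_ge0 ((kappa - lam) ^+ 2 + 2 * lam); lra.
Qed.

End Radius.

(** * The operator [Theta] on coefficients *)

Section Operator.
Variable R : realType.
Local Notation C := (Cplx R).
Implicit Types (z w : C) (r s tau : R) (a b g : nat -> C).

Lemma geo_contract (c : nat -> R) a : (forall k, `|c k| <= 1) -> geo a ->
  geo (fun k => toC (c k) * a k).
Proof.
move=> hc ga r r0 r1; have [M hM] := ga r r0 r1; exists M => k.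
apply: le_trans (hM k); rewrite ler_wpM2r ?exprn_ge0 //.
by rewrite cmodM cmod_toC ler_piMl ?cmod_ge0.
Qed.

(* With [tau = beta / (alpha + p beta)] and [k = p + j], the multiplier
   [(alpha + k beta) / (alpha + p beta)] of [Theta] is [1 + j tau]. *)
Definition theta_coef tau (m : int) g (j : nat) : C :=
  toC ((1 + j%:R * tau) ^ m) * g j.

Lemma theta_base_gt0 tau (j : nat) : 0 < tau -> 0 < 1 + j%:R * tau.
Proof. by move=> t0; rewrite ltr_pwDl // mulr_ge0 // ltW. Qed.

Lemma theta_coefS tau m g j : 0 < tau ->
  theta_coef tau (m + 1) g j =
  theta_coef tau m g j + toC tau * (j%:R * theta_coef tau m g j).
Proof.
move=> t0; rewrite /theta_coef expfzDr ?gt_eqF ?theta_base_gt0 // expr1z.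
by rewrite toCM toCD toCM toC_nat toC1; ring.
Qed.

(** Raising [m] by one adds a multiple of [j] times the coefficient, which [geo_nat] allows; for
    negative [m] the multipliers are at most 1, as [1 + j tau >= 1]. *)
Lemma geo_theta_coef tau m g : 0 < tau -> geo g -> geo (theta_coef tau m g).
Proof.
move=> t0 gg; case: m => n.
  elim: n => [|n IH].
    rewrite (_ : theta_coef tau 0 g = g) //.
    by apply/funext => j; rewrite /theta_coef expr0z toC1 mul1r.
  rewrite (_ : theta_coef tau n.+1 g = (fun j => theta_coef tau n g j +
      toC tau * (j%:R * theta_coef tau n g j))).
    by apply: geoD => //; apply: geoZ; exact: geo_nat.
  by apply/funext => j; rewrite -theta_coefS // -addn1 PoszD.
apply: (geo_contract (c := fun j => (1 + j%:R * tau) ^ Negz n)) => // j.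
have h : 1 <= 1 + j%:R * tau by rewrite lerDl mulr_ge0 // ltW.
have h0 : 0 < 1 + j%:R * tau by exact: theta_base_gt0.
rewrite NegzE -exprnN normfV normrX gtr0_norm //.
by rewrite invf_le1 ?exprn_gt0 // exprn_ege1.
Qed.

Lemma theta_coef0 tau m g : theta_coef tau m g 0%N = g 0%N.
Proof. by rewrite /theta_coef mul0r addr0 exp1rz toC1 mul1r. Qed.

Lemma psum_theta_coefS tau m g z : 0 < tau -> geo g -> cmod z < 1 ->
  psum (theta_coef tau (m + 1) g) z =
  psum (theta_coef tau m g) z +
  toC tau * (z * psum (pderiv (theta_coef tau m g)) z).
Proof.
move=> t0 gg z1; have gt := geo_theta_coef m t0 gg.
rewrite (_ : theta_coef tau (m + 1) g = (fun j => theta_coef tau m g j +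
    toC tau * (j%:R * theta_coef tau m g j))); last first.
  by apply/funext => j; rewrite theta_coefS.
have gn := geo_nat gt; have gz := geoZ (toC tau) gn.
by rewrite psumD // psumZ // psum_nat.
Qed.

Lemma power_partialE (p : nat) a g z n : (forall j, g j.+1 = a (p + j.+1)%N) ->
  g 0%N = 1 ->
  power_partial p a z (n + p.+1) = z ^+ p * series (fun j => g j * z ^+ j) n.+1.
Proof.
move=> ga g0; rewrite /power_partial /series /= big_nat_recl //= g0 expr0 mulr1.
rewrite mulrDr mulr1 mulr_sumr; congr (_ + _).
rewrite (big_addn 0 _ p.+1) addnK; apply: eq_bigr => i _.
by rewrite ga addnC addSnnS exprD; ring.
Qed.

Lemma power_partial_cvg (p : nat) a g z : (forall j, g j.+1 = a (p + j.+1)%N) ->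
  g 0%N = 1 -> geo g -> cmod z < 1 ->
  power_partial p a z @ \oo --> z ^+ p * psum g z.
Proof.
move=> ga g0 gg z1; rewrite -(cvg_shiftn p.+1).
rewrite (_ : (fun n => _) =
    (fun n => z ^+ p * series (fun j => g j * z ^+ j) n.+1)); last first.
  by apply/funext => n; rewrite (power_partialE _ _ ga g0).
apply: cvgMl_tmp.
by have := psum_cvg gg z1; rewrite -cvg_shiftS.
Qed.

Definition shifted_coef (p : nat) a (j : nat) : C :=
  if j is 0 then 1 else a (p + j)%N.

Lemma geo_of_power_partial (p : nat) a :
  (forall z, cmod z < 1 -> cvgn (power_partial p a z)) -> geo (shifted_coef p a).
Proof.
move=> ha r r0 r1; have [->|rn0] := eqVneq r 0.
  exists 1 => -[|j] /=; first by rewrite cmod1 expr0 mulr1.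
  by rewrite expr0n mulr0.
(* [power_partial] never reads [a k] for [k <= p]; putting 0 there turns it, up to the term [z^p],
   into an ordinary series from index 0. *)
have h z : cmod z < 1 ->
    cvgn (series (fun k => (if (k <= p)%N then 0 else a k) * z ^+ k)).
  move=> z1; have /cvg_ex [l hl] := ha _ z1.
  apply/cvg_ex; exists (l - z ^+ p); rewrite -(cvg_shiftn p.+1).
  rewrite (_ : (fun n => _) = (fun n => power_partial p a z (n + p.+1) - z ^+ p)).
    by apply: cvgB; [rewrite (cvg_shiftn p.+1)|exact: cvg_cst].
  apply/funext => n; rewrite /power_partial addrAC subrr add0r /series /=.
  rewrite (@big_cat_nat _ _ _ p.+1) //=; last by rewrite leq_addl.
  rewrite big_nat big1 ?add0r => [|k /andP[_ kp]]; last by rewrite -ltnS kp mul0r.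
  rewrite big_nat [RHS]big_nat; apply: eq_bigr => k /andP[pk _].
  by rewrite leqNgt pk.
have [M hM] := geo_drop p (geo_of_cvg h) r0 r1.
exists (1 + M) => -[|j] /=.
  by rewrite cmod1 expr0 mulr1 lerDl; apply: le_trans (hM 0%N);
    rewrite mulr_ge0 ?cmod_ge0.
have := hM j.+1; rewrite leqNgt -addSnnS ltnS leq_addr /= addSnnS.
by move=> /le_trans; apply; rewrite lerDr.
Qed.

Lemma geo_iter_shift n g : geo g -> geo (iter n (@pshift R) g).
Proof. by move=> gg; elim: n => //= n; exact: geo_shift. Qed.

Lemma psum_iter_shift n g z : geo g -> cmod z < 1 ->
  psum (iter n (@pshift R) g) z = z ^+ n * psum g z.
Proof.
move=> gg z1; elim: n => [|n IH]; first by rewrite expr0 mul1r.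
by rewrite iterS psum_shift ?IH ?exprS ?mulrA //; exact: geo_iter_shift.
Qed.

Lemma taylor_coef_shifted (p : nat) (f : C -> C) g j : geo g ->
  (forall z, cmod z < 1 -> f z = z ^+ p * psum g z) ->
  taylor_coef f (p + j) = g j.
Proof.
move=> gg hf; rewrite (taylor_coef_psum _ (geo_iter_shift p gg)).
  by elim: p {hf}.
by move=> z z1; rewrite hf // psum_iter_shift.
Qed.

Lemma ThetaE (p : nat) m (alpha beta : R) (f : C -> C) g z :
  0 < beta -> 0 < alpha + p%:R * beta -> geo g -> g 0%N = 1 ->
  (forall w, cmod w < 1 -> f w = w ^+ p * psum g w) -> cmod z < 1 ->
  Theta p m alpha beta f z =
  z ^+ p * psum (theta_coef (beta / (alpha + p%:R * beta)) m g) z.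
Proof.
move=> b0 c0 gg g0 hf z1; rewrite /Theta.
have t0 : 0 < beta / (alpha + p%:R * beta) by rewrite divr_gt0.
apply: cvg_lim; first exact: norm_hausdorff.
apply: power_partial_cvg => //; last 2 first.
- by rewrite theta_coef0.
- exact: geo_theta_coef.
move=> j; rewrite (taylor_coef_shifted _ gg hf) /theta_coef; congr (toC (_ ^ _) * _).
by rewrite natrD; field; rewrite gt_eqF.
Qed.

Lemma class_Ap_psum (p : nat) (f : C -> C) : class_Ap p f ->
  exists g, [/\ geo g, g 0%N = 1 &
    forall z, cmod z < 1 -> f z = z ^+ p * psum g z].
Proof.
move=> [_ [a ha]]; exists (shifted_coef p a).
have hz z : cmod z < 1 -> power_partial p a z @ \oo --> f z.
  by move=> /disk_cmod; exact: ha.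
have gg : geo (shifted_coef p a).
  by apply: geo_of_power_partial => z /hz h; apply/cvg_ex; exists (f z).
split => // z z1; transitivity (limn (power_partial p a z)).
  by apply/esym/cvg_lim; [exact: norm_hausdorff|exact: hz].
by apply: cvg_lim; [exact: norm_hausdorff|exact: power_partial_cvg].
Qed.

End Operator.

(** * The inequality inside the radius *)

Section Forward.
Variable R : realType.
Local Notation C := (Cplx R).
Implicit Types (z w : C) (r s tau : R) (a b g : nat -> C).

Lemma quotient_perturbation tau mu k g m z : 0 < tau -> 0 < mu -> 0 <= k ->
  geo g -> g 0%N = 1 ->
  let G n := psum (theta_coef tau n g) in
  (forall w, cmod w < 1 -> G m w != 0) ->
  (forall w, cmod w < 1 -> k < complex.Re (G (m + 1) w / G m w)) ->
  cmod z < 1 ->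
  2 * (mu * tau) * cmod z < (1 - cmod z) * (1 - (1 - 2 * k) * cmod z) ->
  k < complex.Re (toC (1 - mu) * (G (m + 1) z / G m z) +
                  toC mu * (G (m + 1 + 1) z / G (m + 1) z)).
Proof.
move=> t0 m0 k0 gg g0 G G0 hk z1 hz; have r0 := cmod_ge0 z.
have ga := geo_theta_coef (m + 1) t0 gg; have gb := geo_theta_coef m t0 gg.
have a0 : theta_coef tau (m + 1) g 0%N = 1 by rewrite theta_coef0.
have b0 : theta_coef tau m g 0%N = 1 by rewrite theta_coef0.
have SP := schwarz_pick_diag ga gb G0 hk z1.
have RG := Re_quotient_ge ga gb a0 b0 G0 hk z1.
have EA := psum_theta_coefS m t0 gg z1.
have EA2 := psum_theta_coefS (m + 1) t0 gg z1.
have xk := hk _ z1; have B0 := G0 _ z1.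
rewrite -/(G m z) -/(G (m + 1) z) -/(G (m + 1 + 1) z) in SP RG EA EA2.
move: (psum (pderiv (theta_coef tau (m + 1) g)) z)
  (psum (pderiv (theta_coef tau m g)) z) SP EA EA2 => E1 D1 SP EA EA2.
move: (G m z) (G (m + 1) z) (G (m + 1 + 1) z) SP RG EA EA2 xk B0.
move=> B A A2 SP RG EA EA2 xk B0.
set Q := A / B in SP RG xk *; set x := complex.Re Q in SP RG xk *.
have QE : A = Q * B by rewrite divfK.
(* Here [k >= 0] enters: a point with real part above [k] cannot be 0. *)
have Q0 : Q != 0 by apply/eqP => Qz; move: xk; rewrite /x Qz /=; lra.
set r := cmod z in r0 z1 hz SP RG.
set W := B * E1 - A * D1 in SP.
(* [W] is the Wronskian [B^2 Q'], so the right side is [tau z Q' / Q]. *)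
have dE : A2 / A - Q = toC tau * (z * W) / (A * B).
  have A0 : A != 0 by rewrite QE mulf_neq0.
  have -> : toC tau * (z * W) = A2 * B - A * A.
    have -> : A * A = A * (B + toC tau * (z * D1)) by rewrite -EA.
    by rewrite EA2 /W; ring.
  by rewrite /Q; field; rewrite A0 B0.
have qx : x <= cmod Q by apply: le_trans (ler_Re_cmod _); exact: ler_norm.
have Bp : 0 < cmod B by rewrite cmod_gt0.
have Qp : 0 < cmod Q by rewrite cmod_gt0.
set d := cmod (A2 / A - Q).
have d0 : 0 <= d by exact: cmod_ge0.
have r2 : 0 < 1 - r ^+ 2 by rewrite subr_gt0 expr_lt1.
have dQ : d * (1 - r ^+ 2) * cmod Q <= 2 * tau * r * (x - k).
  have -> : d = tau * r * cmod W / (cmod Q * cmod B ^+ 2).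
    have cA : cmod A = cmod Q * cmod B by rewrite -cmodM -QE.
    rewrite /d dE (cmodM _ (_^-1)) cmodV (cmodM A) cA (cmodM (toC tau)) (cmodM z).
    by rewrite cmod_toC gtr0_norm // expr2 !mulrA.
  have -> : tau * r * cmod W / (cmod Q * cmod B ^+ 2) * (1 - r ^+ 2) * cmod Q =
      tau * r * ((1 - r ^+ 2) * cmod W) / cmod B ^+ 2.
    by field; rewrite !gt_eqF.
  rewrite ler_pdivrMr ?exprn_gt0 //.
  have := ler_wpM2l (mulr_ge0 (ltW t0) r0) SP; lra.
set L := 1 - (1 - 2 * k) * r in hz.
(* Since [|Q| >= Re Q], the Harnack bound also controls the [Q] in the denominator of [Q' / Q]. *)
have LQ : L <= (1 + r) * cmod Q.
  have : (1 + r) * x <= (1 + r) * cmod Q by rewrite ler_wpM2l //; lra.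
  by rewrite /L; lra.
have dL : d * ((1 - r) * L) <= 2 * tau * r * (x - k).
  apply: le_trans dQ.
  have -> : d * (1 - r ^+ 2) * cmod Q = d * (1 - r) * ((1 + r) * cmod Q) by ring.
  rewrite [leLHS]mulrA; apply: ler_wpM2l LQ.
  by rewrite mulr_ge0 //; lra.
have md : mu * d < x - k.
  have p0 : 0 < (1 - r) * L.
    by apply: le_lt_trans hz; rewrite !mulr_ge0 // ltW.
  rewrite -(ltr_pM2r p0) -mulrA; apply: le_lt_trans (ler_wpM2l (ltW m0) dL) _.
  have -> : mu * (2 * tau * r * (x - k)) = (x - k) * (2 * (mu * tau) * r) by ring.
  by rewrite ltr_pM2l // subr_gt0.
have -> : toC (1 - mu) * Q + toC mu * (A2 / A) = Q + toC mu * (A2 / A - Q).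
  by rewrite toCD toCN toC1; ring.
rewrite ReCD ReCM /= mul0r subr0 -/x.
have : - d <= complex.Re (A2 / A - Q).
  by rewrite lerNl; apply: le_trans (ler_Re_cmod _); rewrite -normrN ler_norm.
by move/(ler_wpM2l (ltW m0)); rewrite mulrN; lra.
Qed.

Lemma conclusion_within_radius (p : nat) (m : int) (alpha beta mu k : R) (f : C -> C) :
  0 < beta -> 0 < alpha + p%:R * beta -> 0 < mu -> 0 <= k -> k < 1 ->
  class_Ap p f -> hypothesis_on_disk p m alpha beta k 1 f ->
  conclusion_on_disk p m alpha beta mu k (sharp_radius p alpha beta mu k) f.
Proof.
move=> be0 c0 m0 k0 k1 /class_Ap_psum [g [gg g0 hf]] [q [[_ hq] hk]].
rewrite sharp_radiusE //.
have ThE n z := @ThetaE _ p n alpha beta f g z be0 c0 gg g0 hf.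
set tau := beta / (alpha + p%:R * beta) in ThE *.
have t0 : 0 < tau by rewrite divr_gt0.
pose G n := psum (theta_coef tau n g).
have G00 n : G n 0 = 1 by rewrite /G psum0 theta_coef0.
have G0 w : cmod w < 1 -> G m w != 0.
  move=> w1; have [->|w0] := eqVneq w 0; first by rewrite G00 oner_eq0.
  have [] := hq w _ w0; first by apply/disk_cmod.
  by rewrite ThE // mulf_eq0 negb_or => /andP[].
(* At the origin the given [q] is not tied to the quotient; the normalisation gives the value 1
   there. *)
have Re_gt w : cmod w < 1 -> k < complex.Re (G (m + 1) w / G m w).
  move=> w1; have [->|w0] := eqVneq w 0; first by rewrite !G00 divr1.
  have dw : disk 1 w by apply/disk_cmod.
  have [_ qE] := hq w dw w0; have := hk w dw; rewrite qE !ThE //.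
  by rewrite -mulf_div divff ?mul1r // expf_neq0.
have G1 w : cmod w < 1 -> G (m + 1) w != 0.
  move=> w1; apply/eqP => Gz; have := Re_gt w w1.
  by rewrite Gz mul0r /=; lra.
have l0 : 0 < mu * tau by rewrite mulr_gt0.
have D1 := radius_den_gt1 k l0.
have r1 : (radius_den k (mu * tau))^-1 < 1 by rewrite invf_lt1 //; lra.
have gt n := geo_theta_coef n t0 gg.
have quot n : (forall w, cmod w < 1 -> G n w != 0) ->
    analytic_quotient (radius_den k (mu * tau))^-1
      (Theta p (n + 1) alpha beta f) (Theta p n alpha beta f)
      (fun w => G (n + 1) w / G n w).
  move=> Gn; split=> [z /disk_cmod zr|z /disk_cmod zr z0].
    by apply: derivable_quotient; rewrite ?Gn //; lra.
  have z1 : cmod z < 1 by lra.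
  rewrite !ThE // mulf_neq0 ?expf_neq0 ?Gn //; split => //.
  by rewrite -mulf_div divff ?mul1r // expf_neq0.
exists (fun w => G (m + 1) w / G m w), (fun w => G (m + 1 + 1) w / G (m + 1) w).
split; first exact: quot.
- by have := quot (m + 1) G1; rewrite -addrA.
move=> z /disk_cmod zr.
apply: quotient_perturbation => //; first by lra.
by apply: radius_quadratic_gt0 => //; exact: cmod_ge0.
Qed.

End Forward.

(** * The binomial series [(1 - z)^(- s)], handled through its coefficients *)

Section BinomialSeries.
Variable R : realType.
Local Notation C := (Cplx R).
Implicit Types (z w : C) (r s tau k : R).

(* Coefficients of [(1 - z) ^ (- s)]. *)
Fixpoint bcoef s (j : nat) : R :=
  if j is i.+1 then bcoef s i * ((s + i%:R) / i.+1%:R) else 1.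

Definition cbcoef s (j : nat) : C := toC (bcoef s j).

Lemma bcoefS s j : j.+1%:R * bcoef s j.+1 = (s + j%:R) * bcoef s j.
Proof. by rewrite /=; field; rewrite nat1r pnatr_eq0. Qed.

Lemma bcoef_succ s j : s * bcoef (s + 1) j = (s + j%:R) * bcoef s j.
Proof.
elim: j => [|j IH]; first by rewrite /= addr0.
by rewrite /= mulrA IH -natr1; ring.
Qed.

Lemma bcoef_pascal s j : bcoef (s + 1) j.+1 = bcoef (s + 1) j + bcoef s j.+1.
Proof.
have n0 : j.+1%:R != 0 :> R by rewrite pnatr_eq0.
apply: (mulfI n0); rewrite mulrDr !bcoefS -(bcoef_succ s) -natr1; ring.
Qed.

Lemma sum_bcoef s n :
  \sum_(0 <= j < n) bcoef s j.+1 = bcoef (s + 1) n - 1.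
Proof.
elim: n => [|n IH]; first by rewrite big_geq // subrr.
by rewrite big_nat_recr // IH bcoef_pascal [LHS]addrAC.
Qed.

Lemma bcoef_ge0 s j : 0 <= s -> 0 <= bcoef s j.
Proof.
move=> s0; elim: j => [|j IH] /=; first exact: ler01.
by rewrite mulr_ge0 // divr_ge0 // addr_ge0.
Qed.

Lemma bcoef_le0 s j : -1 < s -> s <= 0 -> bcoef s j.+1 <= 0.
Proof.
move=> s1 s0; elim: j => [|j IH]; first by rewrite /= mul1r addr0 divr1.
rewrite -[bcoef s j.+2]/(bcoef s j.+1 * ((s + j.+1%:R) / j.+2%:R)).
rewrite mulr_le0_ge0 // divr_ge0 // -natr1.
by have := ler0n R j; lra.
Qed.

Lemma bounded_of_eventually_decreasing (v : nat -> R) (N : nat) :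
  (forall j, 0 <= v j) -> (forall j, (N <= j)%N -> v j.+1 <= v j) ->
  exists M, forall j, v j <= M.
Proof.
move=> v0 hv; exists (\sum_(0 <= j < N.+1) v j) => j.
have small i : (i <= N)%N -> v i <= \sum_(0 <= j < N.+1) v j.
  move=> iN; rewrite (big_cat_nat _ (n := i.+1)) //= big_nat_recr //=.
  by rewrite -addrA addrCA lerDl addr_ge0 // sumr_ge0.
have [/small //|Nj] := leqP j N.
apply: le_trans (small N (leqnn N)).
rewrite -(subnKC (ltnW Nj)); elim: (j - N)%N => [|i IH]; first by rewrite addn0.
by rewrite addnS; apply: le_trans IH; rewrite hv // leq_addr.
Qed.

Lemma geo_cbcoef s : geo (cbcoef s).
Proof.
(* The ratio of successive terms, [|s + j| r / (j + 1)], is at most 1 once [j >= |s| / (1 - r)]. *)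
move=> r r0 r1; pose N := Num.bound (`|s| / (1 - r)).
apply: (@bounded_of_eventually_decreasing _ N) => j.
  by rewrite mulr_ge0 ?cmod_ge0 ?exprn_ge0.
move=> Nj; rewrite /cbcoef !cmod_toC /= normrM exprS.
rewrite [leLHS](_ : _ = `|bcoef s j| * r ^+ j * (`|(s + j%:R) / j.+1%:R| * r)); last by ring.
rewrite ler_piMr ?mulr_ge0 ?exprn_ge0 //.
rewrite normrM normfV (@ger0_norm _ j.+1%:R) // mulrAC ler_pdivrMr ?ltr0n // mul1r.
have sj : `|s + j%:R| <= `|s| + j%:R by have := ler_normD s j%:R; rewrite (@ger0_norm _ j%:R).
have : `|s| / (1 - r) <= j%:R.
  apply: le_trans (_ : N%:R <= _); last by rewrite ler_nat.
  by apply/ltW/archi_boundP; rewrite divr_ge0 //; lra.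
rewrite ler_pdivrMr; last by lra.
rewrite -natr1; have := normr_ge0 s; have := ler_wpM2r r0 sj; nra.
Qed.

Lemma psum_cbcoef_succ s z : cmod z < 1 ->
  (1 - z) * psum (cbcoef (s + 1)) z = psum (cbcoef s) z.
Proof.
move=> z1; have g1 := geo_cbcoef (s + 1); have g0 := geo_cbcoef s.
have gs := geo_shift g1.
suff : psum (cbcoef (s + 1)) z = z * psum (cbcoef (s + 1)) z + psum (cbcoef s) z.
  by move=> E; rewrite mulrBl mul1r {1}E; ring.
rewrite -psum_shift // -psumD //; congr (psum _ z).
apply/funext => -[|j]; first by rewrite /= add0r.
by rewrite /cbcoef bcoef_pascal toCD.
Qed.

(* For [-1 < s <= 0] the coefficients after the first are nonpositive with
   partial sums at least [-1]. *)
Lemma psum_cbcoef_neq0 s z : -1 < s -> cmod z < 1 -> psum (cbcoef s) z != 0.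
Proof.
move=> s1 z1; have [n hn] : exists n : nat, s <= n%:R.
  by exists (Num.bound `|s|); apply: le_trans (ler_norm _) (ltW _); exact: archi_boundP.
have base t : -1 < t -> t <= 0 -> psum (cbcoef t) z != 0.
  move=> t1 t0; have gt := geo_cbcoef t.
  apply/eqP; rewrite psum_behead // => /eqP; rewrite addr_eq0 => /eqP E.
  have : cmod (psum (fun j => cbcoef t j.+1) z) <= 1.
    apply: cmod_lim_le (psum_cvg (geo_behead gt) z1) => i.
    apply: le_trans (ler_cmod_sum _ _) _.
    apply: (@le_trans _ _ (\sum_(0 <= j < i) - bcoef t j.+1)).
      apply: ler_sum => j _; rewrite cmodM cmod_toC cmodX ler0_norm ?bcoef_le0 //.
      by rewrite ler_piMr ?oppr_ge0 ?bcoef_le0 // exprn_ile1 ?cmod_ge0 // ltW.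
    rewrite sumrN sum_bcoef opprB gerDl oppr_le0 bcoef_ge0 //; lra.
  have := congr1 (@cmod R) E; rewrite cmodN cmodM /cbcoef /= cmod_toC normr1.
  by have := cmod_ge0 z; nra.
(* Lowering [s] by 1 multiplies the series by [1 - z]; enough such steps bring [s] into the range of
   [base]. *)
elim: n s s1 hn => [|n IH] t t1 tn; first exact: base.
have [t0|t0] := leP t 0; first exact: base.
have : psum (cbcoef (t - 1)) z != 0 by apply: IH; [lra|move: tn; rewrite -natr1; lra].
by rewrite -psum_cbcoef_succ // subrK; apply: contra => /eqP ->; rewrite mulr0.
Qed.

(** The differential equation [(1 - z) F' = s F] times [z], whose coefficientwise form is
    [bcoefS]. *)
Lemma psum_cbcoef_euler s z : cmod z < 1 ->
  (1 - z) * psum (fun j => j%:R * cbcoef s j) z = toC s * z * psum (cbcoef s) z.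
Proof.
move=> z1; have g0 := geo_cbcoef s; have gn := geo_nat g0.
set E := psum (fun j => _) z.
suff : E = z * E + toC s * (z * psum (cbcoef s) z).
  by move=> EE; rewrite mulrBl mul1r {1}EE; ring.
rewrite /E -!psum_shift // -psumZ; [|exact: geo_shift|by []].
rewrite -psumD; [|exact: geo_shift|by apply: geoZ; exact: geo_shift|by []].
congr (psum _ z); apply/funext => -[|j] /=; first by rewrite mul0r mulr0 addr0.
by rewrite -toC_nat -toCM bcoefS toCM toCD toC_nat mulrDl addrC.
Qed.

(** The previous equation after one more application of [z d/dz]. *)
Lemma psum_cbcoef_euler2 s z : cmod z < 1 ->
  (1 - z) * psum (fun j => j%:R * (j%:R * cbcoef s j)) z =
  z * (toC s * psum (cbcoef s) z +
       (toC s + 1) * psum (fun j => j%:R * cbcoef s j) z).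
Proof.
move=> z1; have g0 := geo_cbcoef s; have gn := geo_nat g0; have gn2 := geo_nat gn.
set E := psum (fun j => _ * (_ * _)) z.
set h := fun j => toC s * cbcoef s j + (toC s + 1) * (j%:R * cbcoef s j).
have gh : geo h by apply: geoD; exact: geoZ.
have hE : psum h z = toC s * psum (cbcoef s) z +
    (toC s + 1) * psum (fun j => j%:R * cbcoef s j) z.
  by rewrite psumD ?psumZ //; exact: geoZ.
suff : E = z * E + z * psum h z.
  by move=> EE; rewrite mulrBl mul1r {1}EE -hE; ring.
rewrite /E -!psum_shift // -psumD; [|exact: geo_shift|exact: geo_shift|by []].
congr (psum _ z); apply/funext => -[|j] /=; first by rewrite mul0r addr0.
rewrite -{2}toC_nat -toCM bcoefS toCM toCD toC_nat /h -/(cbcoef s j) -natr1; ring.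
Qed.

(** [u = z / (1 - z)] satisfies [u = z (1 + u)], so it lies closer to 0 than to -1. *)
Lemma Re_half_plane z : cmod z < 1 -> -1 < 2 * complex.Re (z / (1 - z)).
Proof.
move=> z1; set u := z / (1 - z).
have z0 : 1 - z != 0.
  by rewrite subr_eq0; apply: contraTneq z1 => <-; rewrite cmod1 ltxx.
have uE : u = z * (1 + u) by rewrite /u; field.
have u1 : 0 < cmod (1 + u).
  by rewrite cmod_gt0; apply/eqP => h; move: uE; rewrite h mulr0 => u0;
    move: h; rewrite u0 addr0 => /eqP; rewrite oner_eq0.
have : cmod u ^+ 2 < cmod (1 + u) ^+ 2.
  rewrite ltr_pXn2r ?nnegrE ?cmod_ge0 // {1}uE cmodM.
  by rewrite -[ltRHS]mul1r ltr_pM2r.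
by rewrite !cmod_ReIm !ReCD !ImCD /= add0r; lra.
Qed.

End BinomialSeries.

(** * The extremal function *)

Section Sharpness.
Variable R : realType.
Local Notation C := (Cplx R).
Implicit Types (z w : C) (r s tau k : R).

Lemma theta_coefK tau m (g : nat -> C) : 0 < tau ->
  theta_coef tau m (theta_coef tau (- m) g) = g.
Proof.
move=> t0; apply/funext => j; rewrite /theta_coef mulrA -toCM.
by rewrite -expfzDr ?subrr ?expr0z ?toC1 ?mul1r // gt_eqF // theta_base_gt0.
Qed.

Lemma class_Ap_iter_shift (p : nat) (g : nat -> C) : geo g -> g 0%N = 1 ->
  class_Ap p (psum (iter p (@pshift R) g)).
Proof.
move=> gg g0; split.
  by move=> z /disk_cmod z1; have [] := psum_is_derive (geo_iter_shift p gg) z1.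
exists (fun i => g (i - p)%N) => z /disk_cmod z1; rewrite psum_iter_shift //.
by apply: power_partial_cvg => // j; rewrite addKn.
Qed.

(* At the radius, the extremal function attains the bound at the real point
   [- x]; here [tau * s = 2 * (1 - k)]. *)
Lemma extremal_value (mu tau s k x : R) :
  tau * s = 2 * (1 - k) -> 0 < x -> 0 < tau -> 0 < 1 - (1 - 2 * k) * x ->
  (1 - x) * (1 - (1 - 2 * k) * x) = 2 * (mu * tau) * x ->
  let e := - (s * x) / (1 + x) in
  let e2 := - (x * (s + (s + 1) * e)) / (1 + x) in
  (1 - mu) * (1 + tau * e) + mu * ((1 + tau * e + tau * (e + tau * e2)) /
    (1 + tau * e)) = k.
Proof.
move=> ts x0 t0; set L := 1 - _ => L0 hL e e2.
have x1 : 1 + x != 0 by rewrite gt_eqF //; lra.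
have te : tau * e = - (2 * (1 - k) * x) / (1 + x) by rewrite -ts /e; field.
have a0 : 1 + tau * e = L / (1 + x) by rewrite te /L; field.
have te2 : tau * (tau * e2) =
    - (x * (tau * (2 * (1 - k)) + (2 * (1 - k) + tau) * (tau * e))) / (1 + x).
  by rewrite -ts /e2; field.
rewrite (mulrDr tau e) te2 a0 te.
have Ln0 : L != 0 by rewrite gt_eqF.
have -> : (1 - mu) * (L / (1 + x)) + mu * ((L / (1 + x) + (- (2 * (1 - k) * x) / (1 + x) +
    - (x * (tau * (2 * (1 - k)) + (2 * (1 - k) + tau) * (- (2 * (1 - k) * x) / (1 + x))))
      / (1 + x))) / (L / (1 + x))) =
    k + (1 - k) / ((1 + x) * L) * ((1 - x) * L - 2 * (mu * tau) * x).
  move: Ln0; rewrite /L => Ln0; field; by rewrite ?x1 ?Ln0.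
by rewrite hL subrr mulr0 addr0.
Qed.

Lemma sharpness (p : nat) (m : int) (alpha beta mu k r : R) :
  0 < beta -> 0 < alpha + p%:R * beta -> 0 < mu -> 0 <= k -> k < 1 ->
  sharp_radius p alpha beta mu k < r ->
  exists f : C -> C, [/\ class_Ap p f, hypothesis_on_disk p m alpha beta k 1 f &
    ~ conclusion_on_disk p m alpha beta mu k r f].
Proof.
move=> be0 c0 m0 k0 k1; rewrite sharp_radiusE //.
set tau := beta / (alpha + p%:R * beta).
have t0 : 0 < tau by rewrite divr_gt0.
have l0 : 0 < mu * tau by rewrite mulr_gt0.
(* At the reciprocal of [radius_den] the first factor of [radius_quadratic] vanishes, so [x] is a
   root of the quadratic. *)
have D1 := radius_den_gt1 k l0; have := radius_quadratic k (radius_den k (mu * tau))^-1 l0.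
rewrite mulfV ?gt_eqF //; last by lra.
rewrite subrr mul0r => /eqP; rewrite subr_eq0 => /eqP.
set x := (radius_den k (mu * tau))^-1.
have x0 : 0 < x by rewrite invr_gt0; lra.
have x1 : x < 1 by rewrite invf_lt1 //; lra.
clearbody x => hx xr.
pose s := 2 * (1 - k) / tau.
have ts : tau * s = 2 * (1 - k) by rewrite /s; field; rewrite gt_eqF.
have s0 : 0 < s by rewrite divr_gt0 // mulr_gt0 // subr_gt0.
clearbody s.
(* The inverse multipliers are built in, so that order [m] of the operator returns the binomial
   series. *)
pose g := theta_coef tau (- m) (cbcoef s).
have gc := geo_cbcoef s.
have gg : geo g by exact: geo_theta_coef.
have g0 : g 0%N = 1 by rewrite /g theta_coef0.
pose f := psum (iter p (@pshift R) g).
have hf z : cmod z < 1 -> f z = z ^+ p * psum g z by exact: psum_iter_shift.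
have ThE n z := @ThetaE _ p n alpha beta f g z be0 c0 gg g0 hf.
rewrite -/tau in ThE.
pose G n := psum (theta_coef tau n g).
have Gm : G m = psum (cbcoef s) by rewrite /G theta_coefK.
pose E z := psum (fun j => j%:R * cbcoef s j) z.
pose E2 z := psum (fun j => j%:R * (j%:R * cbcoef s j)) z.
have gE := geo_nat gc; have gE2 := geo_nat gE.
have cS : theta_coef tau (m + 1) g =
    (fun j => cbcoef s j + toC tau * (j%:R * cbcoef s j)).
  by apply/funext => j; rewrite theta_coefS // theta_coefK.
have cS2 : theta_coef tau (m + 2) g = (fun j => theta_coef tau (m + 1) g j +
    toC tau * (j%:R * cbcoef s j + toC tau * (j%:R * (j%:R * cbcoef s j)))).
  apply/funext => j; rewrite (_ : m + 2 = m + 1 + 1) -?addrA //.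
  by rewrite addrA theta_coefS // cS; ring.
have GE z : cmod z < 1 -> G (m + 1) z = G m z + toC tau * E z.
  move=> z1; rewrite /G cS -/(G m) Gm psumD ?psumZ //; exact: geoZ.
have GE2 z : cmod z < 1 -> G (m + 2) z =
    G (m + 1) z + toC tau * (E z + toC tau * E2 z).
  move=> z1; rewrite /G cS2 -/(G (m + 1)).
  have h1 := geoZ (toC tau) gE2; have h2 := geoD gE h1.
  have h3 := geoZ (toC tau) h2; have h4 := geo_theta_coef (m + 1) t0 gg.
  by rewrite psumD // psumZ // psumD // psumZ.
have G0 z : cmod z < 1 -> G m z != 0.
  by move=> z1; rewrite Gm psum_cbcoef_neq0 //; lra.
have z_neq1 z : cmod z < 1 -> 1 - z != 0.
  by move=> z1; rewrite subr_eq0; apply: contraTneq z1 => <-; rewrite cmod1 ltxx.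
have Ediv z : cmod z < 1 -> E z = toC s * z / (1 - z) * G m z.
  move=> z1; apply: (mulfI (z_neq1 z z1)); rewrite psum_cbcoef_euler // Gm.
  by field; exact: z_neq1.
have Qdiv z : cmod z < 1 -> G (m + 1) z / G m z =
    1 + toC (2 * (1 - k)) * (z / (1 - z)).
  move=> z1; rewrite GE // Ediv // -ts toCM.
  by field; rewrite G0 // z_neq1.
exists f; split.
- exact: class_Ap_iter_shift.
- exists (fun z => G (m + 1) z / G m z); split; last first.
    move=> z /disk_cmod z1; rewrite Qdiv // ReCD ReCM /= mul0r subr0.
    have h : 0 < (1 - k) * (2 * complex.Re (z / (1 - z)) + 1).
      by rewrite mulr_gt0 ?subr_gt0 //; have := Re_half_plane z1; lra.
    lra.
  split=> [z /disk_cmod z1|z /disk_cmod z1 z0].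
    by apply: derivable_quotient; rewrite ?G0 //; exact: geo_theta_coef.
  rewrite !ThE // mulf_neq0 ?expf_neq0 ?G0 //; split => //.
  by rewrite -mulf_div divff ?mul1r // expf_neq0.
move=> [q1 [q2 [[_ h1] [_ h2] hc]]].
(* This point lies inside the disk of radius [r > x]. The combination equals [k] there, so the
   strict inequality fails. *)
pose z : C := toC (- x).
have zx : cmod z = x by rewrite cmod_toC normrN gtr0_norm.
have z1 : cmod z < 1 by rewrite zx.
have zr : disk r z by apply/disk_cmod; rewrite zx.
have z0 : z != 0 by rewrite -cmod_gt0 zx.
have pz : z ^+ p != 0 by exact: expf_neq0.
have x11 : 1 + x != 0 by rewrite gt_eqF //; lra.
have [_ q1E] := h1 z zr z0; have [_ q2E] := h2 z zr z0.
have := hc z zr; rewrite q1E q2E !ThE // -!mulf_div divff // !mul1r.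
rewrite -/(G (m + 1)) -/(G m) -/(G (m + 2)).
have L0 : 0 < 1 - (1 - 2 * k) * x.
  have -> : 1 - (1 - 2 * k) * x = 1 - x + 2 * k * x by ring.
  by rewrite ltr_wpDr ?subr_gt0 // !mulr_ge0 // ltW.
(* [e] and [e2] are the values at [- x] of [E / G m] and [E2 / G m], from the two Euler
   equations. *)
pose e : R := - (s * x) / (1 + x).
pose e2 : R := - (x * (s + (s + 1) * e)) / (1 + x).
have XV := extremal_value ts x0 t0 L0 hx; rewrite /= -/e -/e2 in XV.
have ed : e = s * - x / (1 + x) by rewrite /e mulrN.
have e2d : (1 + x) * e2 = - x * (s + (s + 1) * e) by rewrite /e2; field.
clearbody e2; clearbody e.
have z1E : 1 - z = toC (1 + x) by rewrite /z toCN opprK toCD toC1.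
have eE : E z = toC e * G m z.
  rewrite Ediv // z1E /z; congr (_ * _).
  by rewrite ed -toCM -toCV -toCM.
have e2E : E2 z = toC e2 * G m z.
  apply: (mulfI (z_neq1 z z1)); rewrite psum_cbcoef_euler2 // -/(E z) eE -Gm z1E.
  rewrite [RHS]mulrA -toCM e2d (toCM (- x)) (toCD s) (toCM (s + 1)) (toCD s) toC1.
  by rewrite -/z; ring.
have AE : G (m + 1) z = toC (1 + tau * e) * G m z.
  by rewrite GE // eE toCD toC1 toCM; ring.
have A2E : G (m + 2) z = toC (1 + tau * e + tau * (e + tau * e2)) * G m z.
  rewrite GE2 // AE eE e2E (toCD (1 + _)) (toCM tau (e + _)) (toCD e) (toCM tau e2).
  ring.
have B0 := G0 z z1.
rewrite A2E AE mulfK // -mulf_div divff // mulr1 -toCV -!toCM -toCD.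
by rewrite XV /= ltxx.
Qed.

End Sharpness.

Theorem theorem3p2 (R : realType) (p : nat) (m : int)
    (alpha beta mu A B kappa : R)
    (hp : (0 < p)%N) (hbeta : 0 < beta) (hc : 0 < alpha + p%:R * beta)
    (hmu : 0 < mu) (hB : -1 <= B) (hBA : B < A) (hA : A <= 1)
    (hkappa : kappa = (1 - A) / (1 - B)) :
  (forall f : Cplx R -> Cplx R,
     class_Ap p f ->
     hypothesis_on_disk p m alpha beta kappa 1 f ->
     conclusion_on_disk p m alpha beta mu kappa
       (sharp_radius p alpha beta mu kappa) f)
  /\
  (forall r : R, sharp_radius p alpha beta mu kappa < r ->
     ~ (forall f : Cplx R -> Cplx R,
          class_Ap p f ->
          hypothesis_on_disk p m alpha beta kappa 1 f ->
          conclusion_on_disk p m alpha beta mu kappa r f)).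
Proof.
have B1 : 0 < 1 - B by lra.
have k0 : 0 <= kappa by rewrite hkappa divr_ge0 //; lra.
have k1 : kappa < 1 by rewrite hkappa ltr_pdivrMr // mul1r; lra.
split=> [f|r hr h]; first exact: conclusion_within_radius.
have [f [f_Ap f_hyp f_not]] := sharpness m hbeta hc hmu k0 k1 hr.
exact/f_not/h.
Qed.
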